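(* Let $V$ be a vertex operator algebra. (a) If $g(V)_{\ge0}V=V$, then every $g(V)_{\ge0}$-homomorphism between weak $V$-modules is a $V$-homomorphism, and every quasi-intertwining operator among any weak $V$-modules is an intertwining operator. (b) If $g(V)_{\ge0}V\ne V$ and $\dim V>1$, then there exist $V$-modules $W_1,W_2$ and a $g(V)_{\ge0}$-homomorphism $W_1\to W_2$ that is not a $V$-homomorphism, and there exist $V$-modules and a quasi-intertwining operator among them that is not an intertwining operator.
   Context: A weak $V$-module is a module for $V$ regarded as a vertex algebra; $L(-1)=\omega_0$. $g(V)_{\ge0}W=\mathrm{span}\{v_nw\mid v\in V,n\ge0,w\in W\}$ for a weak module $W$ ($Y_W(v,x)=\sum_nv_nx^{-n-1}$). A $g(V)_{\ge0}$-homomorphism is a linear map $f$ with $f(v_nw)=v_nf(w)$ for $v\in V$, $n\ge0$; a $V$-homomorphism satisfies this for all $n\in\mathbb Z$. A quasi-intertwining operator of type $\binom{W_3}{W_1\,W_2}$ is a linear map $W_1\otimes W_2\to W_3\{x\}$, $w_{(1)}\otimes w_{(2)}\mapsto{\mathcal Y}(w_{(1)},x)w_{(2)}=\sum_{n\in\mathbb C}(w_{(1)})_nw_{(2)}x^{-n-1}$, with $(w_{(1)})_nw_{(2)}=0$ for $\mathrm{Re}\,n\gg0$, the commutator formula $Y_3(v,x_1){\mathcal Y}(w_{(1)},x_2)w_{(2)}-{\mathcal Y}(w_{(1)},x_2)Y_2(v,x_1)w_{(2)}=\mathrm{Res}_{x_0}x_2^{-1}\delta(\frac{x_1-x_0}{x_2}){\mathcal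 Y}(Y_1(v,x_0)w_{(1)},x_2)w_{(2)}$, and $\frac{d}{dx}{\mathcal Y}(w_{(1)},x)={\mathcal Y}(L(-1)w_{(1)},x)$. It is an intertwining operator if moreover $x_0^{-1}\delta(\frac{x_1-x_2}{x_0})Y_3(v,x_1){\mathcal Y}(w_{(1)},x_2)w_{(2)}-x_0^{-1}\delta(\frac{x_2-x_1}{-x_0}){\mathcal Y}(w_{(1)},x_2)Y_2(v,x_1)w_{(2)}=x_2^{-1}\delta(\frac{x_1-x_0}{x_2}){\mathcal Y}(Y_1(v,x_0)w_{(1)},x_2)w_{(2)}$. *)

(* Defs.v *)
From HB Require Import structures.
From mathcomp Require Import all_boot all_order all_algebra.
From mathcomp Require Import complex Rstruct.
Set Implicit Arguments. Unset Strict Implicit. Unset Printing Implicit Defensive.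
Import Order.TTheory GRing.Theory Num.Theory.
Local Open Scope ring_scope.

Definition C : numClosedFieldType := (Rdefinitions.R)[i].

Definition binC (p : C) (i : nat) : C :=
  (\prod_(k < i) (p - k%:R)) / (i`!)%:R.

(** Linear maps and bilinear "mode" maps  F a n b = a_n b. *)
Definition lin (A B : lmodType C) (f : A -> B) :=
  forall (a : C) (x y : A), f (a *: x + y) = a *: f x + f y.

Definition bilin (A B D : lmodType C) (I : Type) (F : A -> I -> B -> D) :=
  (forall n (a : C) (u1 u2 : A) (w : B), F (a *: u1 + u2) n w = a *: F u1 n w + F u2 n w) /\
  (forall n (a : C) (u : A) (w1 w2 : B), F u n (a *: w1 + w2) = a *: F u n w1 + F u n w2).

Definition in_span (A : lmodType C) (P : A -> Prop) (x : A) :=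
  exists (k : nat) (a : 'I_k -> C) (b : 'I_k -> A),
    (forall i, P (b i)) /\ x = \sum_(i < k) a i *: b i.

Definition fin_dim_sub (A : lmodType C) (P : A -> Prop) :=
  exists (k : nat) (b : 'I_k -> A),
    forall x, P x -> exists a : 'I_k -> C, x = \sum_(i < k) a i *: b i.

Definition dim_le1 (A : lmodType C) :=
  exists e : A, forall x : A, exists a : C, x = a *: e.

Section VOADefs.
Variables (V : lmodType C) (Y : V -> int -> V -> V) (vac om : V).
(* Y u n v = u_n v, i.e. Y(u,x) v = \sum_n u_n v x^{-n-1} *)

Definition truncated (A B D : lmodType C) (F : A -> int -> B -> D) :=
  forall (u : A) (w : B), exists N : int, forall n : int, N <= n -> F u n w = 0.

(** Jacobi identity for YW (weak module action of (V,Y)), written coefficientwise: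
    the coefficient of x0^{-r-1} x1^{-p-1} x2^{-q-1} of the Jacobi identity
      x0^{-1}d((x1-x2)/x0) YW(u,x1)YW(v,x2)w - x0^{-1}d((x2-x1)/-x0) YW(v,x2)YW(u,x1)w
        = x2^{-1}d((x1-x0)/x2) YW(Y(u,x0)v,x2)w,
    i.e.  sum_i binom(p,i) (u_{r+i}v)_{p+q-i} w
        = sum_i (-1)^i binom(r,i) (u_{p+r-i} v_{q+i} w - (-1)^r v_{q+r-i} u_{p+i} w);
    the (a priori infinite, but finitely supported) sums are cut at any N beyond
    which all the summands vanish. *)
Definition jacobi_mod (W : lmodType C) (YW : V -> int -> W -> W) :=
  forall (u v : V) (w : W) (p q r : int) (N : nat),
    (forall i : nat, (N <= i)%N ->
       [/\ Y u (r + i%:Z) v = 0, YW v (q + i%:Z) w = 0 & YW u (p + i%:Z) w = 0]) ->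
    \sum_(i < N) binC p%:~R i *: YW (Y u (r + i%:Z) v) (p + q - i%:Z) w =
    \sum_(i < N) ((-1) ^+ i * binC r%:~R i) *:
        (YW u (p + r - i%:Z) (YW v (q + i%:Z) w)
         - (-1) ^ r *: YW v (q + r - i%:Z) (YW u (p + i%:Z) w)).

Definition vacuum_id (W : lmodType C) (YW : V -> int -> W -> W) :=
  forall (n : int) (w : W), YW vac n w = if n == -1 then w else 0.

Definition weak_module (W : lmodType C) (YW : V -> int -> W -> W) :=
  [/\ bilin YW, truncated YW, vacuum_id YW & jacobi_mod YW].

(** L(n) = omega_{n+1}; L(0)-eigenspaces. *)
Definition is_VOA :=
  [/\ weak_module Y /\
      (forall v : V, Y v (-1) vac = v),
      (forall (v : V) (n : int), 0 <= n -> Y v n vac = 0),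
      (exists c : C, forall (m n : int) (v : V),
          Y om (m + 1) (Y om (n + 1) v) - Y om (n + 1) (Y om (m + 1) v) =
          (m - n)%:~R *: Y om (m + n + 1) v
          + (if m + n == 0 then ((m ^+ 3 - m)%:~R / 12%:R * c) *: v else 0)),
      (forall (v : V) (n : int) (w : V), Y (Y om 0 v) n w = - n%:~R *: Y v (n - 1) w)
    & [/\ Y om 1 om = 2%:R *: om,
          (forall v : V, exists (k : nat) (ns : 'I_k -> int) (vs : 'I_k -> V),
              (forall i, Y om 1 (vs i) = (ns i)%:~R *: vs i) /\ v = \sum_(i < k) vs i),
                                                       (* V = (+)_{n in Z} V_(n) *)
          (forall n : int, fin_dim_sub (fun v : V => Y om 1 v = n%:~R *: v))
        & (exists N : int, forall n : int, n < N ->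
              forall v : V, Y om 1 v = n%:~R *: v -> v = 0)]].

Definition V_module (W : lmodType C) (YW : V -> int -> W -> W) :=
  [/\ weak_module YW,
      (forall w : W, exists (k : nat) (hs : 'I_k -> C) (ws : 'I_k -> W),
          (forall i, YW om 1 (ws i) = hs i *: ws i) /\ w = \sum_(i < k) ws i),
      (forall h : C, fin_dim_sub (fun w : W => YW om 1 w = h *: w))
    & (forall h : C, exists N : int, forall n : int, n < N ->
          forall w : W, YW om 1 w = (h + n%:~R) *: w -> w = 0)].

Definition gV_ge0_full :=
  forall x : V, in_span (fun y : V => exists (u v : V) (n : int), 0 <= n /\ y = Y u n v) x.

Definition g_hom (W1 W2 : lmodType C) (Y1 : V -> int -> W1 -> W1)
  (Y2 : V -> int -> W2 -> W2) (f : W1 -> W2) :=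
  lin f /\ forall (v : V) (n : int) (w : W1), 0 <= n -> f (Y1 v n w) = Y2 v n (f w).

Definition V_hom (W1 W2 : lmodType C) (Y1 : V -> int -> W1 -> W1)
  (Y2 : V -> int -> W2 -> W2) (f : W1 -> W2) :=
  lin f /\ forall (v : V) (n : int) (w : W1), f (Y1 v n w) = Y2 v n (f w).

(** Quasi-intertwining operators of type (W3 / W1 W2):
    I w1 n w2 = (w1)_n w2, i.e. Y(w1,x)w2 = \sum_{n in C} (w1)_n w2 x^{-n-1}. *)
Definition quasi_intertwining (W1 W2 W3 : lmodType C)
  (Y1 : V -> int -> W1 -> W1) (Y2 : V -> int -> W2 -> W2) (Y3 : V -> int -> W3 -> W3)
  (I : W1 -> C -> W2 -> W3) :=
  [/\ bilin I,
      (forall (w1 : W1) (w2 : W2), exists N : int,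
          forall n : C, N%:~R < 'Re n -> I w1 n w2 = 0),
      (* commutator formula, coefficient of x1^{-p-1} x2^{-q-1}:
         v_p (w1)_q w2 - (w1)_q v_p w2 = sum_{i>=0} binom(p,i) (v_i w1)_{p+q-i} w2 *)
      (forall (v : V) (w1 : W1) (w2 : W2) (p : int) (q : C) (N : nat),
          (forall i : nat, (N <= i)%N -> Y1 v i%:Z w1 = 0) ->
          Y3 v p (I w1 q w2) - I w1 q (Y2 v p w2) =
          \sum_(i < N) binC p%:~R i *: I (Y1 v i%:Z w1) (p%:~R + q - i%:R) w2)
    & (* L(-1)-derivative property: d/dx Y(w1,x) = Y(L(-1)w1,x) *)
      (forall (w1 : W1) (n : C) (w2 : W2), I (Y1 om 0 w1) n w2 = - n *: I w1 (n - 1) w2)].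

(** Intertwining operator: quasi-intertwining + Jacobi identity (coefficientwise,
    coefficient of x0^{-r-1} x1^{-p-1} x2^{-q-1}, p r in Z, q in C). *)
Definition intertwining (W1 W2 W3 : lmodType C)
  (Y1 : V -> int -> W1 -> W1) (Y2 : V -> int -> W2 -> W2) (Y3 : V -> int -> W3 -> W3)
  (I : W1 -> C -> W2 -> W3) :=
  quasi_intertwining Y1 Y2 Y3 I /\
  forall (v : V) (w1 : W1) (w2 : W2) (p r : int) (q : C) (N : nat),
    (forall i : nat, (N <= i)%N ->
       [/\ Y1 v (r + i%:Z) w1 = 0, I w1 (q + i%:R) w2 = 0 & Y2 v (p + i%:Z) w2 = 0]) ->
    \sum_(i < N) binC p%:~R i *: I (Y1 v (r + i%:Z) w1) (p%:~R + q - i%:R) w2 =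
    \sum_(i < N) ((-1) ^+ i * binC r%:~R i) *:
        (Y3 v (p + r - i%:Z) (I w1 (q + i%:R) w2)
         - (-1) ^ r *: I w1 (q + r%:~R - i%:R) (Y2 v (p + i%:Z) w2)).

End VOADefs.

(* Main.v *)
Require Import Defs.
From HB Require Import structures.
From mathcomp Require Import all_boot all_order all_algebra.
From mathcomp Require Import complex Rstruct.
From mathcomp Require Import boolp ring zify.
Set Implicit Arguments. Unset Strict Implicit. Unset Printing Implicit Defensive.
Import Order.TTheory GRing.Theory Num.Theory.
Local Open Scope ring_scope.

(** The failure of the Jacobi identity is linear in all its arguments and obeys a
    one-step recursion in the power of [x0]; for a quasi-intertwining operator (or,
    in the simpler case, a homomorphism for nonnegative modes) it vanishes for
    [r >= 0]. The key point is that it also vanishes on every [v_n w] with [n >= 0]: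
    choosing [P] with [u_(P+i) w = 0] for [i >= 0], the Jacobi identity writes
    [u_m v_n w] through nonnegative modes of iterates [u_j v] and terms
    [u_(m-i) v_(n+i) w], [i > 0], already under control. Consequently, for fixed [w],
    the failure seen as a function of the vector [v] of [V] is itself an object of
    the same kind defined on [V]. If [V] is spanned by the [v_n v'] with [n >= 0], the
    key point applied to this new object shows that it satisfies the full Jacobi
    identity; since it kills the vacuum, it is zero.
    Conversely, [V] is spanned by its nonnegative modes and the finite-dimensional
    space [V_(0)], so if these modes do not span [V] some nonzero functional [l] kills
    them; then [w |-> l w *: vac] and [w1 (x) w2 |-> l w1 *: w2] are the
    counterexamples. *)

(** The recursion in [r] leads only upwards from [r = 0]. It can be reversed because a defect that
    vanishes at [r + 1] depends at [r] on [p + q] alone. If it also vanishes for all large [p], it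
    is zero; this settles the vectors [v_n w]. Otherwise it is a series in one variable, that is, an
    operator with integer modes, and this is how the new object on [V] arises for intertwining
    operators. For such operators the key point meets an obstacle: [u(x1)], [v(x2)] and [I(x)] are
    related only through commutators. Therefore the commutator of [I(x)] with the product
    [u(x1) v(x2)] is compared with its commutator with the iterate of [u] and [v], both multiplied
    by [(x1 - x)^P (x2 - x)^m]. The exponent [P] is chosen to kill [[u(x1), I(x)]], which removes
    the product in reversed order once the mode of [u] is large, and [m] brings out the vector
    [v_m w1]. *)

Section InfiniteSum.
Variable W : lmodType C.
Implicit Types g h : nat -> W.

Definition fin g := exists N : nat, forall i : nat, (N <= i)%N -> g i = 0.

(** Truncation bounds depend on the vectors involved; a sum without a bound lets identities be
    chained without tracking them. The value is independent of the chosen bound by [isumE], and [0]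
    is a mere default off finite support. *)
Definition isum g : W :=
  match pselect (fin g) with
  | left e => \sum_(i < projT1 (cid e)) g i
  | right _ => 0
  end.

Lemma big_trunc g N M : (N <= M)%N -> (forall i, (N <= i)%N -> g i = 0) ->
  \sum_(i < M) g i = \sum_(i < N) g i.
Proof.
move=> NM g0; rewrite -!(big_mkord xpredT) (big_cat_nat _ (n := N)) //=.
by rewrite [X in _ + X]big_nat_cond [X in _ + X]big1 ?addr0 // => i /andP[/andP[/g0]].
Qed.

Lemma isumE g N : (forall i, (N <= i)%N -> g i = 0) -> isum g = \sum_(i < N) g i.
Proof.
move=> gN; rewrite /isum; case: pselect => [e|]; last by case; exists N.
case: (cid e) => M /= gM; case: (leqP N M) => NM; first exact: big_trunc.
by rewrite (big_trunc (ltnW NM)).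
Qed.

Lemma eq_isum g h : g =1 h -> isum g = isum h.
Proof. by move=> /funext ->. Qed.

Lemma isum0 : isum (fun=> 0) = 0.
Proof. by rewrite (@isumE _ 0%N) ?big_ord0. Qed.

Lemma isum_eq0 g : (forall i, g i = 0) -> isum g = 0.
Proof. by move=> g0; rewrite -[RHS]isum0; exact: eq_isum. Qed.

Lemma fin_common g h : fin g -> fin h ->
  exists N, forall i, (N <= i)%N -> g i = 0 /\ h i = 0.
Proof.
move=> [N gN] [M hM]; exists (maxn N M) => i; rewrite geq_max => /andP[Ni Mi].
by rewrite gN ?hM.
Qed.

Lemma finZ g (a : nat -> C) : fin g -> fin (fun i => a i *: g i).
Proof. by move=> [N gN]; exists N => i /gN ->; rewrite scaler0. Qed.

Lemma isumD g h : fin g -> fin h -> isum (fun i => g i + h i) = isum g + isum h.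
Proof.
move=> fg fh; have [N gh] := fin_common fg fh.
rewrite (@isumE _ N) => [|i /gh[-> ->]]; last exact: addr0.
by rewrite (@isumE g N) ?(@isumE h N) ?big_split // => i /gh[].
Qed.

Lemma isumZ g (a : C) : fin g -> isum (fun i => a *: g i) = a *: isum g.
Proof.
by move=> [N gN]; rewrite !(@isumE _ N) ?scaler_sumr // => i /gN ->; rewrite scaler0.
Qed.

Lemma isumN g : fin g -> isum (fun i => - g i) = - isum g.
Proof.
by move=> fg; rewrite -scaleN1r -isumZ //; apply: eq_isum => i; rewrite scaleN1r.
Qed.

Lemma finN g : fin g -> fin (fun i => - g i).
Proof. by move=> [N gN]; exists N => i /gN ->; rewrite oppr0. Qed.

Lemma isumB g h : fin g -> fin h -> isum (fun i => g i - h i) = isum g - isum h.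
Proof. by move=> fg fh; rewrite isumD ?isumN //; exact: finN. Qed.

Lemma isumS g : fin g -> isum g = g 0%N + isum (fun i => g i.+1).
Proof.
move=> [N gN]; rewrite (@isumE g N.+1) => [|i Ni]; last by rewrite gN // ltnW.
by rewrite (@isumE _ N) ?big_ord_recl // => i Ni; rewrite gN // ltnW.
Qed.

End InfiniteSum.

Lemma lin0 (A B : lmodType C) (f : A -> B) : lin f -> f 0 = 0.
Proof. by move=> /(_ (-1) 0 0); rewrite scaler0 addr0 scaleN1r addNr. Qed.

Lemma linD (A B : lmodType C) (f : A -> B) : lin f -> {morph f : x y / x + y}.
Proof. by move=> lf x y; rewrite -[x]scale1r lf !scale1r. Qed.

Lemma linZ (A B : lmodType C) (f : A -> B) : lin f -> forall (a : C), {morph f : x / a *: x}.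
Proof. by move=> lf a x; rewrite -[a *: x]addr0 lf lin0 // addr0. Qed.

Lemma linN (A B : lmodType C) (f : A -> B) : lin f -> {morph f : x / - x}.
Proof. by move=> lf x; rewrite -scaleN1r linZ // scaleN1r. Qed.

Lemma linB (A B : lmodType C) (f : A -> B) : lin f -> {morph f : x y / x - y}.
Proof. by move=> lf x y; rewrite linD // linN. Qed.

Lemma lin_sum (A B : lmodType C) (f : A -> B) (I : Type) (r : seq I) (P : pred I) (g : I -> A) :
  lin f -> f (\sum_(i <- r | P i) g i) = \sum_(i <- r | P i) f (g i).
Proof. by move=> lf; rewrite (big_morph f (linD lf) (lin0 lf)). Qed.

Lemma lin_fin (A B : lmodType C) (f : A -> B) (g : nat -> A) :
  lin f -> fin g -> fin (fun i => f (g i)).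
Proof. by move=> lf [N gN]; exists N => i /gN ->; rewrite lin0. Qed.

Lemma lin_isum (A B : lmodType C) (f : A -> B) (g : nat -> A) :
  lin f -> fin g -> f (isum g) = isum (fun i => f (g i)).
Proof.
by move=> lf [N gN]; rewrite !(@isumE _ _ N) ?lin_sum // => i /gN ->; rewrite lin0.
Qed.

Section DoubleSum.
Variable W : lmodType C.
Implicit Type G : nat -> nat -> W.

Definition fin2 G := exists N : nat, forall i j : nat, (N <= i)%N || (N <= j)%N -> G i j = 0.

Lemma fin2_row G i : fin2 G -> fin (G i).
Proof. by move=> [N GN]; exists N => j Nj; apply: GN; rewrite Nj orbT. Qed.

Lemma fin2_isum G : fin2 G -> fin (fun i => isum (G i)).
Proof.
by move=> [N GN]; exists N => i Ni; apply: isum_eq0 => j; rewrite GN // Ni.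
Qed.

Lemma fin2_tr G : fin2 G -> fin2 (fun i j => G j i).
Proof. by move=> [N GN]; exists N => i j; rewrite orbC => /GN. Qed.

Lemma fin2Z G (a : nat -> nat -> C) : fin2 G -> fin2 (fun i j => a i j *: G i j).
Proof. by move=> [N GN]; exists N => i j /GN ->; rewrite scaler0. Qed.

Lemma isum2E G N : (forall i j : nat, (N <= i)%N || (N <= j)%N -> G i j = 0) ->
  isum (fun i => isum (G i)) = \sum_(i < N) \sum_(j < N) G i j.
Proof.
move=> GN; rewrite (@isumE _ _ N) => [|i Ni].
  by apply: eq_bigr => i _; apply: isumE => j Nj; rewrite GN // Nj orbT.
by apply: isum_eq0 => j; rewrite GN // Ni.
Qed.

Lemma exchange_isum G : fin2 G ->
  isum (fun i => isum (G i)) = isum (fun j => isum (fun i => G i j)).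
Proof.
move=> [N GN]; rewrite !(@isum2E _ N) => [|i j|//]; last by rewrite orbC => /GN.
exact: exchange_big.
Qed.

(** Summation along the antidiagonals [t = i + j]. On the support both indices are below [N], so
    [t < N + N]. *)
Lemma isum_triangle G : fin2 G ->
  isum (fun t => \sum_(i < t.+1) G i (t - i)%N) = isum (fun i => isum (G i)).
Proof.
move=> [N GN]; rewrite (@isum2E _ N) // (@isumE _ _ (N + N)%N); last first.
  move=> t Nt; apply: big1 => i _; apply: GN; lia.
transitivity (\sum_(0 <= t < N + N) \sum_(0 <= i < N + N | (i <= t)%N) G i (t - i)%N).
  rewrite big_mkord; apply: eq_bigr => t _.
  rewrite -(big_mkord xpredT (fun i => G i (t - i)%N)) /= (big_nat_widen _ _ (N + N)%N) //.
rewrite (exchange_big_dep xpredT) //= big_mkord.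
rewrite (big_trunc (g := fun i => \sum_(0 <= t < N + N | (i <= t)%N) G i (t - i)%N) (N := N)).
- apply: eq_bigr => -[i iN] _ /=.
  rewrite (big_cat_nat _ (n := i)) //=; last lia.
  rewrite big_nat_cond big1 ?add0r; last by move=> t; lia.
  rewrite -[X in \sum_(X <= _ < _ | _) _]add0n big_addn big_mkord.
  rewrite -(@big_trunc _ _ N (N + N - i)%N); [|lia|by move=> j Nj; rewrite GN // Nj orbT].
  rewrite big_mkcond; apply: eq_bigr => j _; rewrite leq_addl addnK //.
- lia.
- by move=> i Ni; apply: big1 => t _; rewrite GN // Ni.
Qed.

End DoubleSum.

(** * Generalized binomial coefficients and their convolutions *)

Section GeneralizedBinomial.
Variable F : numFieldType.
Implicit Type x : F.

(** Stated over an abstract field; at [C] it is [binC] by conversion. *)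
Definition gbin x (i : nat) : F := (\prod_(k < i) (x - k%:R)) / (i`!)%:R.

Lemma gbin0 x : gbin x 0 = 1.
Proof. by rewrite /gbin big_ord0 fact0 divr1. Qed.

Lemma gbinS x i : i.+1%:R * gbin x i.+1 = (x - i%:R) * gbin x i.
Proof.
have fact_neq0 : (i`!)%:R != 0 :> F by rewrite pnatr_eq0 -lt0n fact_gt0.
have i1 : i.+1%:R != 0 :> F by rewrite pnatr_eq0.
rewrite /gbin big_ord_recr /= factS natrM.
by field; rewrite fact_neq0 -[1]/(1%:R) -natrD add1n i1.
Qed.

Lemma gbin_pascal x i : gbin (x + 1) i.+1 = gbin x i.+1 + gbin x i.
Proof.
have i1 : i.+1%:R != 0 :> F by rewrite pnatr_eq0.
elim: i i1 => [|i IHi] i1.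
  by apply: (mulfI i1); rewrite mulrDr !gbinS !gbin0; ring.
have i2 : i.+1%:R != 0 :> F by rewrite pnatr_eq0.
apply: (mulfI i1); rewrite gbinS IHi // [RHS]mulrDr gbinS.
have -> : x + 1 - i.+1%:R = x - i%:R by ring.
by rewrite [LHS]mulrDr -gbinS; ring.
Qed.

Lemma gbin_trinomial x (i n : nat) :
  gbin x (i + n) * 'C(i + n, i)%:R = gbin x i * gbin (x - i%:R) n.
Proof.
elim: n => [|n IHn]; first by rewrite addn0 binn gbin0.
have n1 : n.+1%:R != 0 :> F by rewrite pnatr_eq0.
apply: (mulfI n1); rewrite [RHS]mulrCA gbinS [RHS]mulrCA -IHn addnS.
have e : n.+1%:R * 'C((i + n).+1, i)%:R = (i + n).+1%:R * 'C(i + n, i)%:R :> F.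
  rewrite -!natrM; congr _%:R.
  by have := mul_bin_down (i + n).+1 i; rewrite /= => ->; congr (_ * _)%N; lia.
by rewrite mulrCA e mulrA [_ * (i + n).+1%:R]mulrC gbinS natrD; ring.
Qed.

End GeneralizedBinomial.

Definition binz (p : int) (i : nat) : C := binC p%:~R i.
(** The coefficient of [y^i] in [(1 - y)^r]. *)
Definition sbin (r : int) (i : nat) : C := (-1) ^+ i * binz r i.

Lemma binzE (p : int) i : binz p i = gbin (p%:~R : C) i.
Proof. by []. Qed.

Lemma binz0 (p : int) : binz p 0 = 1.
Proof. exact: gbin0. Qed.

Lemma binz_pascal (p : int) i : binz (p + 1) i.+1 = binz p i.+1 + binz p i.
Proof. by rewrite !binzE rmorphD gbin_pascal. Qed.

Lemma binz_nat (n i : nat) : binz n%:Z i = 'C(n, i)%:R.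
Proof.
elim: n i => [|n IHn] [|i]; rewrite ?binz0 ?bin0 //.
  by rewrite bin0n /binz /binC big_ord_recl /= subrr !mul0r.
have -> : n.+1%:Z = n%:Z + 1 by lia.
by rewrite binz_pascal !IHn binS natrD.
Qed.

Lemma binz_small (n i : nat) : (n < i)%N -> binz n%:Z i = 0.
Proof. by move=> ni; rewrite binz_nat bin_small. Qed.

Lemma sbin0 r : sbin r 0 = 1.
Proof. by rewrite /sbin binz0 mulr1. Qed.

Lemma sbin_pascal r i : sbin (r + 1) i.+1 = sbin r i.+1 - sbin r i.
Proof. by rewrite /sbin binz_pascal exprS; ring. Qed.

Lemma binz0S i : binz 0 i.+1 = 0.
Proof. exact: (@binz_small 0). Qed.

Lemma sbin0S i : sbin 0 i.+1 = 0.
Proof. by rewrite /sbin binz0S mulr0. Qed.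

Lemma binz_trinomial (x : int) (i n : nat) :
  binz x (i + n) * 'C(i + n, i)%:R = binz x i * binz (x - i%:Z) n.
Proof. by rewrite !binzE gbin_trinomial rmorphB. Qed.

Section BinomialSums.
Variable W : lmodType C.
Implicit Type g : nat -> W.
Implicit Type G : nat -> nat -> W.

Lemma finS g : fin g -> fin (fun i => g i.+1).
Proof. by move=> [N gN]; exists N => i Ni; apply: gN; lia. Qed.

(** With [S] the shift of sequences, the sum is the value at [0] of [(1 + S)^p g]; the identity
    splits off one factor [1 + S]. *)
Lemma isum_binz_pascal (p : int) g : fin g ->
  isum (fun i => binz (p + 1) i *: g i) =
  isum (fun i => binz p i *: g i) + isum (fun i => binz p i *: g i.+1).
Proof.
move=> fg; have fg1 := finS fg.
rewrite isumS; last exact: finZ.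
rewrite [X in _ = X + _]isumS; last exact: finZ.
rewrite !binz0 -addrA -isumD; [|exact: finZ|exact: finZ].
by congr (_ + _); apply: eq_isum => i; rewrite binz_pascal scalerDl.
Qed.

Lemma isum_sbin_pascal (r : int) g : fin g ->
  isum (fun i => sbin (r + 1) i *: g i) =
  isum (fun i => sbin r i *: g i) - isum (fun i => sbin r i *: g i.+1).
Proof.
move=> fg; have fg1 := finS fg.
rewrite isumS; last exact: finZ.
rewrite [X in _ = X - _]isumS; last exact: finZ.
rewrite !sbin0 -addrA -isumB; [|exact: finZ|exact: finZ].
by congr (_ + _); apply: eq_isum => i; rewrite sbin_pascal scalerBl.
Qed.

Lemma isum_binz0 g : isum (fun i => binz 0 i *: g i) = g 0%N.
Proof.
rewrite (@isumE _ _ 1%N) ?big_ord1 ?binz0 ?scale1r // => -[//|i] _.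
by rewrite binz0S scale0r.
Qed.

Lemma isum_sbin0 g : isum (fun i => sbin 0 i *: g i) = g 0%N.
Proof.
rewrite (@isumE _ _ 1%N) ?big_ord1 ?sbin0 ?scale1r // => -[//|i] _.
by rewrite sbin0S scale0r.
Qed.

Lemma isum_trinomial (x : int) G : fin2 G ->
  isum (fun t => binz x t *: isum (fun i => binz t%:Z i *: G i (t - i)%N)) =
  isum (fun i => isum (fun n => (binz x i * binz (x - i%:Z) n) *: G i n)).
Proof.
move=> fG.
rewrite -[RHS]isum_triangle; last exact: fin2Z.
apply: eq_isum => t; rewrite (@isumE _ _ t.+1) => [|i ti]; last by rewrite binz_small ?scale0r.
rewrite scaler_sumr; apply: eq_bigr => -[i /=]; rewrite ltnS => it _.
by rewrite scalerA -binz_trinomial subnKC // binz_nat.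
Qed.

Lemma fin_fin2_add g : fin g -> fin2 (fun n j => g (n + j)%N).
Proof. by move=> [N gN]; exists N => i j ij; apply: gN; lia. Qed.

(** This is [(1 + S)^(y + p) = (1 + S)^y (1 + S)^p] for the shift [S]; one natural exponent allows
    induction by Pascal's rule. *)
Lemma isum_vandermonde (y : int) (p : nat) g : fin g ->
  isum (fun n => binz (y + p%:Z) n *: g n) =
  isum (fun j => binz p%:Z j *: isum (fun n => binz y n *: g (n + j)%N)).
Proof.
elim: p g => [|p IHp] g fg.
  by rewrite isum_binz0 addr0; apply: eq_isum => n; rewrite addn0.
have fg1 := finS fg.
have -> : y + p.+1%:Z = (y + p%:Z) + 1 by lia.
have -> : p.+1%:Z = p%:Z + 1 by lia.
rewrite isum_binz_pascal // !IHp // isum_binz_pascal.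
  congr (_ + _); apply: eq_isum => j; congr (_ *: _); apply: eq_isum => n.
  by rewrite addnS.
apply: (@fin2_isum _ (fun j n => binz y n *: g (n + j)%N)).
apply: (@fin2Z _ (fun j n => g (n + j)%N) (fun=> binz y)).
exact: fin2_tr (fin_fin2_add fg).
Qed.

(* The change of variables [x1 - x = (x1 - x2) + (x2 - x)] in the coefficients
   of [x1^x x2^p], followed by Vandermonde's identity. *)
Lemma isum_trinomial_vandermonde (x : int) (p : nat) G : fin2 G ->
  isum (fun t => isum (fun j => (binz x t * binz p%:Z j) *:
    isum (fun i => binz t%:Z i *: G i (t - i + j)%N))) =
  isum (fun i => isum (fun n => (binz x i * binz (x - i%:Z + p%:Z) n) *: G i n)).
Proof.
move=> fG; have [N GN] := fG.
have fGj j : fin2 (fun i n => G i (n + j)%N).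
  by exists N => i n ij; apply: GN; lia.
have fT : fin2 (fun t j => isum (fun i => binz t%:Z i *: G i (t - i + j)%N)).
  exists (N + N)%N => t j tj; apply: isum_eq0 => i.
  case: (leqP i t) => it; last by rewrite binz_small ?scale0r.
  by rewrite GN ?scaler0 //; lia.
rewrite exchange_isum; last exact: (fin2Z (fun t j => binz x t * binz p%:Z j)).
transitivity (isum (fun j => binz p%:Z j *:
    isum (fun i => isum (fun n => (binz x i * binz (x - i%:Z) n) *: G i (n + j)%N)))).
  apply: eq_isum => j; rewrite -(isum_trinomial _ (fGj j)) -isumZ.
    by apply: eq_isum => t; rewrite scalerA mulrC.
  apply: finZ; have [M TM] := fT; exists M => t tM.
  by apply: TM; rewrite tM.
transitivity (isum (fun j => isum (fun i => (binz p%:Z j) *: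
    isum (fun n => (binz x i * binz (x - i%:Z) n) *: G i (n + j)%N)))).
  apply: eq_isum => j; rewrite isumZ //; apply: fin2_isum; exact: fin2Z (fGj j).
rewrite exchange_isum; last first.
  exists N => j i ji; rewrite isum_eq0 ?scaler0 // => n.
  by rewrite GN ?scaler0 //; lia.
apply: eq_isum => i.
have fGi := fin2_row i fG.
transitivity (binz x i *: isum (fun j => binz p%:Z j *:
    isum (fun n => binz (x - i%:Z) n *: G i (n + j)%N))).
  rewrite -isumZ.
    apply: eq_isum => j; rewrite [RHS]scalerA [binz x i * _]mulrC -[RHS]scalerA -[binz x i *: _]isumZ.
      by congr (_ *: _); apply: eq_isum => n; rewrite scalerA.
    by exists N => n Nn; rewrite GN ?scaler0 //; lia.
  exists N => j Nj; rewrite isum_eq0 ?scaler0 // => n.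
  by rewrite GN ?scaler0 //; lia.
rewrite -isum_vandermonde // -isumZ; last exact: finZ.
by apply: eq_isum => n; rewrite scalerA.
Qed.

End BinomialSums.

(** * Coefficients of products and iterates, and multiplication by a difference of variables *)

Section ModeRecursion.
Variable W : lmodType C.
Implicit Type h : int -> int -> W.

(* For [h a c = v_a (w1)_c w2], the coefficient of [x1^(-a-1) x^(-c-1)] in the
   product multiplied by [(x1 - x)^r], expanded in nonnegative powers of [x]. *)
Definition product_modes h (r a c : int) : W := isum (fun i => sbin r i *: h (a + r - i%:Z) (c + i%:Z)).

(* For [h r c = (v_r w1)_c w2], the coefficient of [x0^(-r-1) x1^(-p-1) x^(-q-1)]
   in the iterate with [x1 = x + x0]. *)
Definition iterate_modes h (r p q : int) : W := isum (fun i => binz p i *: h (r + i%:Z) (p + q - i%:Z)).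

Definition bounded_right h (c : int) :=
  exists N : nat, forall i : nat, (N <= i)%N -> forall a, h a (c + i%:Z) = 0.

Definition bounded_left h :=
  exists N : int, forall r : int, N <= r -> forall c, h r c = 0.

Lemma int_index (N x : int) : exists M : nat, forall i : nat, (M <= i)%N -> N <= x + i%:Z.
Proof. by exists `|N - x|%N => i; lia. Qed.

Lemma bounded_right_fin h c (f : nat -> int) : bounded_right h c ->
  fin (fun i => h (f i) (c + i%:Z)).
Proof. by move=> [N hN]; exists N => i Ni; rewrite hN. Qed.

Lemma bounded_left_fin h r (f : nat -> int) : bounded_left h -> fin (fun i => h (r + i%:Z) (f i)).
Proof.
by move=> [N hN]; have [M HM] := int_index N r; exists M => i /HM Hr; exact: hN.
Qed.

Lemma product_modes0 h a c : product_modes h 0 a c = h a c.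
Proof. by rewrite /product_modes isum_sbin0; congr (h _ _); lia. Qed.

Lemma iterate_modes0 h r q : iterate_modes h r 0 q = h r q.
Proof. by rewrite /iterate_modes isum_binz0; congr (h _ _); lia. Qed.

Lemma product_modes_rec h r a c : bounded_right h c ->
  product_modes h (r + 1) a c = product_modes h r (a + 1) c - product_modes h r a (c + 1).
Proof.
move=> hc; rewrite /product_modes isum_sbin_pascal; last exact: (bounded_right_fin (fun i => a + (r + 1) - i%:Z)).
by congr (_ - _); apply: eq_isum => i; congr (_ *: h _ _); lia.
Qed.

Lemma iterate_modes_rec h r p q : bounded_left h ->
  iterate_modes h (r + 1) p q = iterate_modes h r (p + 1) q - iterate_modes h r p (q + 1).
Proof.
move=> hl; rewrite /iterate_modes isum_binz_pascal; last exact: (bounded_left_fin r (fun i => p + 1 + q - i%:Z)).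
rewrite addrAC.
have -> : isum (fun i => binz p i *: h (r + i%:Z) (p + 1 + q - i%:Z)) =
          isum (fun i => binz p i *: h (r + i%:Z) (p + (q + 1) - i%:Z)).
  by apply: eq_isum => i; congr (_ *: h _ _); lia.
by rewrite subrr add0r; apply: eq_isum => i; congr (_ *: h _ _); lia.
Qed.

Lemma int_ind_up (P : int -> Prop) : P 0 -> (forall r, P r -> P (r + 1)) -> forall n : nat, P n%:Z.
Proof.
move=> P0 PS; elim=> [//|n IHn].
have -> : n.+1%:Z = n%:Z + 1 by lia.
exact: PS.
Qed.

Lemma int_ind_down (P : int -> Prop) (M : int) : (forall r, M <= r -> P r) ->
  (forall r, P (r + 1) -> P r) -> forall r, P r.
Proof.
move=> PM Pd r; have [n] : exists n : nat, M <= r + n%:Z by exists `|M - r|%N; lia.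
elim: n r => [|n IHn] r Hr; first by apply: PM; lia.
by apply/Pd/IHn; lia.
Qed.

(* The identity [x0 = x1 - x2] on coefficients of [x0^(-r-1) x1^(-p-1) x2^(-q-1)]. *)
Definition mode_rec (D : int -> int -> int -> W) :=
  forall r p q, D (r + 1) p q = D r (p + 1) q - D r p (q + 1).

Lemma mode_rec_ge0 D : mode_rec D -> (forall p q, D 0 p q = 0) ->
  forall (n : nat) p q, D n%:Z p q = 0.
Proof.
move=> rD D0 n; apply: (int_ind_up (P := fun r => forall p q, D r p q = 0)) => // r IHr p q.
by rewrite rD !IHr subr0.
Qed.

(** A series killed by [x1 - x2] is a series in one variable times a delta function, so raising [p]
    amounts to raising [q]. *)
Lemma mode_rec_transfer D r : mode_rec D -> (forall p q, D (r + 1) p q = 0) ->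
  forall p q p' q', p + q = p' + q' -> D r p q = D r p' q'.
Proof.
move=> rD D1.
have step p q : D r (p + 1) q = D r p (q + 1).
  by apply/eqP; rewrite -subr_eq0 -rD D1.
have up (n : nat) p q : D r (p + n%:Z) q = D r p (q + n%:Z).
  elim: n p q => [|n IHn] p q; first by rewrite !addr0.
  have -> : p + n.+1%:Z = (p + n%:Z) + 1 by lia.
  rewrite step IHn; congr (D _ _ _); lia.
move=> p q p' q' e.
wlog le_pp : p q p' q' e / p <= p'.
  move=> H; case: (leP p p') => pp; first exact: H.
  by apply/esym/H; [lia | exact: ltW].
have -> : p' = p + `|p' - p|%N%:Z by lia.
rewrite up; congr (D _ _ _); lia.
Qed.

(** For negative [r], vanishing at [r + 1] lets the coefficient slide along constant [p + q] into
    the region [A <= p]. The bound [A] has to serve all [r] at once. *)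
Lemma mode_rec_eq0 D : mode_rec D -> (forall p q, D 0 p q = 0) ->
  (exists A : int, forall r p q, A <= p -> D r p q = 0) -> forall r p q, D r p q = 0.
Proof.
move=> rD D0 [A DA].
apply: (@int_ind_down _ 0) => [r r0 p q|r IHr p q].
  have -> : r = `|r|%N%:Z by lia.
  exact: mode_rec_ge0.
by rewrite (mode_rec_transfer rD IHr (p' := A) (q' := p + q - A)) ?DA //; lia.
Qed.

End ModeRecursion.

Lemma defect_addB (U : zmodType) (a b c d e f : U) :
  (a - b) - (c - d) + (e - f) = (a - c + e) - (b - d + f).
Proof. by rewrite !opprD !opprK (AC ((2*2)*2) ((1*3*5)*(2*4*6))%AC). Qed.

Lemma defect_addD (U : zmodType) (a b c d e f : U) :
  (a + b) - (c + d) + (e + f) = (a - c + e) + (b - d + f).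
Proof. by rewrite !opprD (AC ((2*2)*2) ((1*3*5)*(2*4*6))%AC). Qed.

Lemma isum_head (W : lmodType C) (g : nat -> W) : (forall i, g i.+1 = 0) -> isum g = g 0%N.
Proof. by move=> g0; rewrite (@isumE _ _ 1%N) ?big_ord1 // => -[|i] //. Qed.

Lemma isum_scale_lin (W : lmodType C) (b : nat -> C) (a : C) (g h : nat -> W) :
  fin g -> fin h ->
  isum (fun i => b i *: (a *: g i + h i)) =
  a *: isum (fun i => b i *: g i) + isum (fun i => b i *: h i).
Proof.
move=> fg fh; rewrite -isumZ; last exact: finZ.
rewrite -isumD; [|apply: finZ; exact: finZ|exact: finZ].
by apply: eq_isum => i; rewrite scalerDr !scalerA [a * _]mulrC.
Qed.

Lemma bilin_linl (A B D : lmodType C) (T : Type) (F : A -> T -> B -> D) n w :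
  bilin F -> lin (fun u => F u n w).
Proof. by move=> [Fl _] a x y; exact: Fl. Qed.

Lemma bilin_linr (A B D : lmodType C) (T : Type) (F : A -> T -> B -> D) u n :
  bilin F -> lin (F u n).
Proof. by move=> [_ Fr] a x y; exact: Fr. Qed.

(** * The defect of the Jacobi identity *)

Section Jacobi.
Variables (V W1 W2 W3 : lmodType C).
Variables (Y1 : V -> int -> W1 -> W1) (Y2 : V -> int -> W2 -> W2) (Y3 : V -> int -> W3 -> W3).
Variable I : W1 -> int -> W2 -> W3.

(** The three terms of the Jacobi identity. In [right_term] the two operators change places, hence
    the order [r q p], and [(-1) ^ r] comes from reading [(x1 - x2)^r] as [(-x2 + x1)^r]. *)
Definition iter_term v w1 w2 := iterate_modes (fun r c => I (Y1 v r w1) c w2).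
Definition left_term v w1 w2 := product_modes (fun a c => Y3 v a (I w1 c w2)).
Definition right_term v w1 w2 r p q :=
  (-1 : C) ^ r *: product_modes (fun c a => I w1 c (Y2 v a w2)) r q p.

(* Vanishing for all [r], [p], [q] is the Jacobi identity; vanishing for [r = 0]
   is the commutator formula. *)
Definition jacobi_defect v w1 w2 r p q :=
  iter_term v w1 w2 r p q - left_term v w1 w2 r p q + right_term v w1 w2 r p q.

Hypotheses (bY1 : bilin Y1) (bY2 : bilin Y2) (bY3 : bilin Y3) (bI : bilin I).
Hypotheses (tY1 : truncated Y1) (tY2 : truncated Y2) (tI : truncated I).

Lemma iter_bounded v w1 w2 : bounded_left (fun r c => I (Y1 v r w1) c w2).
Proof.
have [N YN] := tY1 v w1; exists N => r /YN -> c.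
exact: (lin0 (bilin_linl c w2 bI)).
Qed.

Lemma left_bounded v w1 w2 c : bounded_right (fun a c => Y3 v a (I w1 c w2)) c.
Proof.
have [N IN] := tI w1 w2; have [M HM] := int_index N c.
by exists M => i /HM /IN -> a; rewrite (lin0 (bilin_linr v a bY3)).
Qed.

Lemma right_bounded v w1 w2 c : bounded_right (fun c a => I w1 c (Y2 v a w2)) c.
Proof.
have [N YN] := tY2 v w2; have [M HM] := int_index N c.
by exists M => i /HM /YN -> a; rewrite (lin0 (bilin_linr w1 a bI)).
Qed.

Lemma iter_rec v w1 w2 : mode_rec (iter_term v w1 w2).
Proof. by move=> r p q; apply: iterate_modes_rec; exact: iter_bounded. Qed.

Lemma left_rec v w1 w2 : mode_rec (left_term v w1 w2).
Proof. by move=> r p q; apply: product_modes_rec; exact: left_bounded. Qed.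

Lemma right_rec v w1 w2 : mode_rec (right_term v w1 w2).
Proof.
move=> r p q; rewrite /right_term product_modes_rec; last exact: right_bounded.
have -> : (-1 : C) ^ (r + 1) = - (-1) ^ r by rewrite expfzDr ?oppr_eq0 ?oner_eq0 // expr1z mulrN1.
by rewrite scaleNr -scalerN opprB scalerBr.
Qed.

Lemma jacobi_defect_rec v w1 w2 : mode_rec (jacobi_defect v w1 w2).
Proof.
move=> r p q; rewrite /jacobi_defect iter_rec left_rec right_rec.
exact: defect_addB.
Qed.

Lemma jacobi_defect_lin1 w1 w2 r p q : lin (fun v => jacobi_defect v w1 w2 r p q).
Proof.
move=> a x y; rewrite /jacobi_defect /iter_term /left_term /right_term /iterate_modes /product_modes.
have -> : isum (fun i => binz p i *: I (Y1 (a *: x + y) (r + i%:Z) w1) (p + q - i%:Z) w2) =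
   a *: isum (fun i => binz p i *: I (Y1 x (r + i%:Z) w1) (p + q - i%:Z) w2) +
   isum (fun i => binz p i *: I (Y1 y (r + i%:Z) w1) (p + q - i%:Z) w2).
  rewrite -isum_scale_lin.
  - by apply: eq_isum => i; rewrite (proj1 bY1) (proj1 bI).
  - exact: (bounded_left_fin r (fun i => p + q - i%:Z) (iter_bounded x w1 w2)).
  - exact: (bounded_left_fin r (fun i => p + q - i%:Z) (iter_bounded y w1 w2)).
have -> : isum (fun i => sbin r i *: Y3 (a *: x + y) (p + r - i%:Z) (I w1 (q + i%:Z) w2)) =
   a *: isum (fun i => sbin r i *: Y3 x (p + r - i%:Z) (I w1 (q + i%:Z) w2)) +
   isum (fun i => sbin r i *: Y3 y (p + r - i%:Z) (I w1 (q + i%:Z) w2)).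
  rewrite -isum_scale_lin.
  - by apply: eq_isum => i; rewrite (proj1 bY3).
  - exact: (bounded_right_fin (fun i => p + r - i%:Z) (left_bounded x w1 w2 q)).
  - exact: (bounded_right_fin (fun i => p + r - i%:Z) (left_bounded y w1 w2 q)).
have -> : isum (fun i => sbin r i *: I w1 (q + r - i%:Z) (Y2 (a *: x + y) (p + i%:Z) w2)) =
   a *: isum (fun i => sbin r i *: I w1 (q + r - i%:Z) (Y2 x (p + i%:Z) w2)) +
   isum (fun i => sbin r i *: I w1 (q + r - i%:Z) (Y2 y (p + i%:Z) w2)).
  rewrite -isum_scale_lin.
  - by apply: eq_isum => i; rewrite (proj1 bY2) (proj2 bI).
  - exact: (bounded_right_fin (fun i => q + r - i%:Z) (right_bounded x w1 w2 p)).
  - exact: (bounded_right_fin (fun i => q + r - i%:Z) (right_bounded y w1 w2 p)).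
by rewrite scalerDr scalerA [_ * a]mulrC -[(a * _) *: _]scalerA defect_addD scalerDr scalerBr.
Qed.

Lemma jacobi_defect_lin2 v w2 r p q : lin (fun w1 => jacobi_defect v w1 w2 r p q).
Proof.
move=> a x y; rewrite /jacobi_defect /iter_term /left_term /right_term /iterate_modes /product_modes.
have -> : isum (fun i => binz p i *: I (Y1 v (r + i%:Z) (a *: x + y)) (p + q - i%:Z) w2) =
   a *: isum (fun i => binz p i *: I (Y1 v (r + i%:Z) x) (p + q - i%:Z) w2) +
   isum (fun i => binz p i *: I (Y1 v (r + i%:Z) y) (p + q - i%:Z) w2).
  rewrite -isum_scale_lin.
  - by apply: eq_isum => i; rewrite (proj2 bY1) (proj1 bI).
  - exact: (bounded_left_fin r (fun i => p + q - i%:Z) (iter_bounded v x w2)).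
  - exact: (bounded_left_fin r (fun i => p + q - i%:Z) (iter_bounded v y w2)).
have -> : isum (fun i => sbin r i *: Y3 v (p + r - i%:Z) (I (a *: x + y) (q + i%:Z) w2)) =
   a *: isum (fun i => sbin r i *: Y3 v (p + r - i%:Z) (I x (q + i%:Z) w2)) +
   isum (fun i => sbin r i *: Y3 v (p + r - i%:Z) (I y (q + i%:Z) w2)).
  rewrite -isum_scale_lin.
  - by apply: eq_isum => i; rewrite (proj1 bI) (proj2 bY3).
  - exact: (bounded_right_fin (fun i => p + r - i%:Z) (left_bounded v x w2 q)).
  - exact: (bounded_right_fin (fun i => p + r - i%:Z) (left_bounded v y w2 q)).
have -> : isum (fun i => sbin r i *: I (a *: x + y) (q + r - i%:Z) (Y2 v (p + i%:Z) w2)) =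
   a *: isum (fun i => sbin r i *: I x (q + r - i%:Z) (Y2 v (p + i%:Z) w2)) +
   isum (fun i => sbin r i *: I y (q + r - i%:Z) (Y2 v (p + i%:Z) w2)).
  rewrite -isum_scale_lin.
  - by apply: eq_isum => i; rewrite (proj1 bI).
  - exact: (bounded_right_fin (fun i => q + r - i%:Z) (right_bounded v x w2 p)).
  - exact: (bounded_right_fin (fun i => q + r - i%:Z) (right_bounded v y w2 p)).
by rewrite scalerDr scalerA [_ * a]mulrC -[(a * _) *: _]scalerA defect_addD scalerDr scalerBr.
Qed.

Lemma jacobi_defect_lin3 v w1 r p q : lin (fun w2 => jacobi_defect v w1 w2 r p q).
Proof.
move=> a x y; rewrite /jacobi_defect /iter_term /left_term /right_term /iterate_modes /product_modes.
have -> : isum (fun i => binz p i *: I (Y1 v (r + i%:Z) w1) (p + q - i%:Z) (a *: x + y)) =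
   a *: isum (fun i => binz p i *: I (Y1 v (r + i%:Z) w1) (p + q - i%:Z) x) +
   isum (fun i => binz p i *: I (Y1 v (r + i%:Z) w1) (p + q - i%:Z) y).
  rewrite -isum_scale_lin.
  - by apply: eq_isum => i; rewrite (proj2 bI).
  - exact: (bounded_left_fin r (fun i => p + q - i%:Z) (iter_bounded v w1 x)).
  - exact: (bounded_left_fin r (fun i => p + q - i%:Z) (iter_bounded v w1 y)).
have -> : isum (fun i => sbin r i *: Y3 v (p + r - i%:Z) (I w1 (q + i%:Z) (a *: x + y))) =
   a *: isum (fun i => sbin r i *: Y3 v (p + r - i%:Z) (I w1 (q + i%:Z) x)) +
   isum (fun i => sbin r i *: Y3 v (p + r - i%:Z) (I w1 (q + i%:Z) y)).
  rewrite -isum_scale_lin.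
  - by apply: eq_isum => i; rewrite (proj2 bI) (proj2 bY3).
  - exact: (bounded_right_fin (fun i => p + r - i%:Z) (left_bounded v w1 x q)).
  - exact: (bounded_right_fin (fun i => p + r - i%:Z) (left_bounded v w1 y q)).
have -> : isum (fun i => sbin r i *: I w1 (q + r - i%:Z) (Y2 v (p + i%:Z) (a *: x + y))) =
   a *: isum (fun i => sbin r i *: I w1 (q + r - i%:Z) (Y2 v (p + i%:Z) x)) +
   isum (fun i => sbin r i *: I w1 (q + r - i%:Z) (Y2 v (p + i%:Z) y)).
  rewrite -isum_scale_lin.
  - by apply: eq_isum => i; rewrite (proj2 bY2) (proj2 bI).
  - exact: (bounded_right_fin (fun i => q + r - i%:Z) (right_bounded v w1 x p)).
  - exact: (bounded_right_fin (fun i => q + r - i%:Z) (right_bounded v w1 y p)).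
by rewrite scalerDr scalerA [_ * a]mulrC -[(a * _) *: _]scalerA defect_addD scalerDr scalerBr.
Qed.

End Jacobi.

(** A module action is the operator [I := YW] with first space [V], so all statements on defects
    apply to it. One [N] serves the three truncations. *)
Lemma weak_module_defect (V W : lmodType C) (Y : V -> int -> V -> V) vac
  (YW : V -> int -> W -> W) : truncated Y -> weak_module Y vac YW ->
  forall u v w r p q, jacobi_defect Y YW YW YW u v w r p q = 0.
Proof.
move=> tY [bW tW _ jac] u v w r p q.
have [N0 Y0] := tY u v; have [M0 HM0] := int_index N0 r.
have [N1 Y1] := tW v w; have [M1 HM1] := int_index N1 q.
have [N2 Y2] := tW u w; have [M2 HM2] := int_index N2 p.
pose N := (M0 + M1 + M2)%N.
have YN i : (N <= i)%N -> [/\ Y u (r + i%:Z) v = 0, YW v (q + i%:Z) w = 0 & YW u (p + i%:Z) w = 0].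
  by move=> Ni; split; [apply/Y0/HM0|apply/Y1/HM1|apply/Y2/HM2]; rewrite /N in Ni; lia.
have := jac u v w p q r N YN => J.
have WZ n x : YW x n 0 = 0 by exact: lin0 (bilin_linr x n bW).
rewrite /jacobi_defect /iter_term /left_term /right_term /iterate_modes /product_modes.
rewrite (@isumE _ _ N) => [|i /YN[-> _ _]]; last by rewrite (lin0 (bilin_linl _ w bW)) scaler0.
rewrite (@isumE _ _ N) => [|i /YN[_ -> _]]; last by rewrite WZ scaler0.
rewrite (@isumE _ _ N) => [|i /YN[_ _ ->]]; last by rewrite WZ scaler0.
rewrite [X in X - _ + _]J; apply/eqP.
rewrite -addrA addr_eq0 opprD opprK scaler_sumr -sumrB.
by apply/eqP/eq_bigr => i _; rewrite scalerBr !scalerA [_ * (-1) ^ r]mulrC.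
Qed.

Lemma in_span_eq0 (A B : lmodType C) (P : A -> Prop) (f : A -> B) (x : A) :
  lin f -> (forall y, P y -> f y = 0) -> in_span P x -> f x = 0.
Proof.
move=> lf f0 [k [a [b [Pb ->]]]]; rewrite lin_sum // big1 // => i _.
by rewrite linZ // f0 ?scaler0.
Qed.

(** * Homomorphisms for nonnegative modes *)

Section WeakModule.
Variables (V W : lmodType C) (Y : V -> int -> V -> V) (vac : V) (YW : V -> int -> W -> W).
Hypotheses (modV : weak_module Y vac Y) (modW : weak_module Y vac YW).

Lemma mode_ge_bound u w : exists n : nat, forall i : nat, YW u (n%:Z + i%:Z) w = 0.
Proof.
have [_ tW _ _] := modW; have [N HN] := tW u w.
by exists `|N|%N => i; apply: HN; lia.
Qed.

(** Of the modes of [vac] only [-1] acts, and [m < 0] keeps it out of the reversed product. Thus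
    every negative mode is a mode [-1] of another vector, so that it suffices to control the
    latter. *)
Lemma vacuum_iterate (a : V) (m : int) (w : W) : m < 0 -> YW (Y a m vac) (-1) w = YW a m w.
Proof.
move=> m0; have [bW tW vW _] := modW; have [bV tV vV _] := modV.
have := weak_module_defect tV modW a vac w m 0 (-1).
rewrite /jacobi_defect /iter_term iterate_modes0 /left_term /right_term /product_modes.
rewrite isum_head; last first.
  move=> i; rewrite vW; have -> : (-1 + i.+1%:Z == -1) = false by lia.
  by rewrite (lin0 (bilin_linr a _ bW)) scaler0.
rewrite isum_eq0; last first.
  move=> i; rewrite vW; have -> : (-1 + m - i%:Z == -1) = false by lia.
  by rewrite scaler0.
rewrite scaler0 addr0 sbin0 scale1r vW addr0 eqxx => /eqP.
by rewrite subr_eq0 => /eqP ->; congr (YW a _ w); lia.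
Qed.

End WeakModule.

Section NonnegativeHomomorphism.
Variables (V W1 W2 : lmodType C) (Y : V -> int -> V -> V) (vac : V).
Variables (Y1 : V -> int -> W1 -> W1) (Y2 : V -> int -> W2 -> W2) (f : W1 -> W2).
Hypotheses (modV : weak_module Y vac Y).
Hypotheses (mod1 : weak_module Y vac Y1) (mod2 : weak_module Y vac Y2) (homf : g_hom Y1 Y2 f).

(* The Jacobi identity for [u_m v_q w], cut at [P] with [u_(P + i) w = 0], expresses
   it through nonnegative modes of the iterates [u_j v] and the terms [u_(m - i) v_(q + i) w]. *)
Lemma g_hom_mode_of_nonneg (u v : V) (w : W1) (q m : int) : 0 <= q ->
  f (Y1 u m (Y1 v q w)) = Y2 u m (f (Y1 v q w)).
Proof.
have [lf hf] := homf; have [bV tV vV _] := modV.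
have [b1 t1 _ _] := mod1; have [b2 t2 _ _] := mod2.
have [n un] := mode_ge_bound mod1 u w.
have [N vN] := t1 v w.
(* The claim for all larger modes is carried along, since the product also contains the terms
   [v_(q + i) w]. *)
suff H : forall q', q <= q' -> 0 <= q' -> forall m, f (Y1 u m (Y1 v q' w)) = Y2 u m (f (Y1 v q' w)).
  by move=> q0; apply: H.
move: q; apply: (@int_ind_down _ N) => [q Nq q' qq' _ m'|q IHq q' qq' q'0 m'].
  by rewrite vN ?(lin0 lf) ?(lin0 (bilin_linr _ _ b1)) ?(lin0 (bilin_linr _ _ b2)) ?(lin0 lf) //; lia.
have [q1|eqq] : q + 1 <= q' \/ q' = q by lia.
  exact: IHq.
(* With [p = n] the leading term of the product is the wanted [u_m' v_q w], as [n + r = m']; the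
   choice of [n] kills the reversed product, in [W2] because [f] commutes with [u_(n + i)]. *)
subst q'; set r := m' - n%:Z.
have J1 := weak_module_defect tV mod1 u v w r n%:Z q.
have J2 := weak_module_defect tV mod2 u v (f w) r n%:Z q.
have R1 : right_term Y1 Y1 u v w r n%:Z q = 0.
  rewrite /right_term /product_modes isum_eq0 ?scaler0 // => i.
  by rewrite un (lin0 (bilin_linr _ _ b1)) scaler0.
have R2 : right_term Y2 Y2 u v (f w) r n%:Z q = 0.
  rewrite /right_term /product_modes isum_eq0 ?scaler0 // => i.
  by rewrite -hf ?un ?(lin0 lf) ?(lin0 (bilin_linr _ _ b2)) ?scaler0 //; lia.
(* As [n] is natural, [binz n i] vanishes for [i > n]; for [i <= n] the mode [n + q - i] is
   nonnegative. *)
have E : f (iter_term Y Y1 u v w r n%:Z q) = iter_term Y Y2 u v (f w) r n%:Z q.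
  rewrite /iter_term /iterate_modes lin_isum //; last first.
    apply: finZ; exact: (bounded_left_fin r (fun i => n%:Z + q - i%:Z)
      (iter_bounded b1 tV u v w)).
  apply: eq_isum => i; rewrite linZ //.
  case: (leqP i n) => ni; last by rewrite binz_small ?scale0r.
  by rewrite hf //; lia.
have {}J1 : f (left_term Y1 Y1 u v w r n%:Z q) = f (iter_term Y Y1 u v w r n%:Z q).
  by move/eqP: J1; rewrite /jacobi_defect R1 addr0 subr_eq0 => /eqP ->.
have {}J2 : left_term Y2 Y2 u v (f w) r n%:Z q = iter_term Y Y2 u v (f w) r n%:Z q.
  by move/eqP: J2; rewrite /jacobi_defect R2 addr0 subr_eq0 => /eqP ->.
have fL : fin (fun i => Y1 u (n%:Z + r - i%:Z) (Y1 v (q + i%:Z) w)).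
  exact: (bounded_right_fin (fun i => n%:Z + r - i%:Z) (left_bounded b1 t1 u v w q)).
have fL2 : fin (fun i => Y2 u (n%:Z + r - i%:Z) (Y2 v (q + i%:Z) (f w))).
  exact: (bounded_right_fin (fun i => n%:Z + r - i%:Z) (left_bounded b2 t2 u v (f w) q)).
have : f (left_term Y1 Y1 u v w r n%:Z q) - left_term Y2 Y2 u v (f w) r n%:Z q = 0.
  by rewrite J1 J2 E subrr.
rewrite /left_term /product_modes lin_isum //; last exact: finZ.
rewrite -isumB; [|by apply: lin_fin => //; exact: finZ|exact: finZ].
rewrite isum_head => [|i].
  rewrite sbin0 !scale1r -hf; last lia.
  have -> : q + 0%N%:Z = q by lia.
  have -> : n%:Z + r - 0%N%:Z = m' by rewrite /r; lia.
  by move/eqP; rewrite subr_eq0 => /eqP.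
rewrite linZ // -hf ?IHq ?subrr //; lia.
Qed.

End NonnegativeHomomorphism.

Lemma isum_single (W : lmodType C) (g : nat -> W) (k : nat) :
  (forall i, i != k -> g i = 0) -> isum g = g k.
Proof.
move=> gk; rewrite (@isumE _ _ k.+1) => [|i ki]; last by rewrite gk // gtn_eqF.
by rewrite big_ord_recr /= big1 ?add0r // => i _; rewrite gk // ltn_eqF.
Qed.

(* For fixed [w], the defect [a |-> f (a_(-1) w) - a_(-1) f w] is itself a
   homomorphism from [V] killing the vacuum, so that [g_hom_mode_of_nonneg] applies to it. *)
Lemma g_hom_V_hom (V W1 W2 : lmodType C) (Y : V -> int -> V -> V) (vac : V)
  (Y1 : V -> int -> W1 -> W1) (Y2 : V -> int -> W2 -> W2) (f : W1 -> W2) :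
  weak_module Y vac Y -> (forall v, Y v (-1) vac = v) -> gV_ge0_full Y ->
  weak_module Y vac Y1 -> weak_module Y vac Y2 -> g_hom Y1 Y2 f -> V_hom Y1 Y2 f.
Proof.
move=> modV creation full mod1 mod2 homf; have [lf hf] := homf.
have [bV tV vV _] := modV; have [b1 t1 v1 _] := mod1; have [b2 t2 v2 _] := mod2.
pose g w (a : V) := f (Y1 a (-1) w) - Y2 a (-1) (f w).
have lg w : lin (g w).
  move=> a x y; rewrite /g (proj1 b1) (proj1 b2) lf.
  by rewrite opprD scalerBr addrACA.
have hg w : g_hom Y Y2 (g w).
  split=> // v n a; case: n => // n _.
  have J1 := weak_module_defect tV mod1 v a w 0 n%:Z (-1).
  have J2 := weak_module_defect tV mod2 v a (f w) 0 n%:Z (-1).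
  move: J1 J2; rewrite /jacobi_defect /left_term /right_term !product_modes0 expr0z !scale1r.
  set L1 := iter_term _ _ _ _ _ _ _ _; set L2 := iter_term _ _ _ _ _ _ _ _ => J1 J2.
  have L : f L1 - L2 = g w (Y v n a).
    have fL1 : fin (fun i => Y1 (Y v (0 + i%:Z) a) (n%:Z + (-1) - i%:Z) w).
      exact: (bounded_left_fin 0 (fun i => n%:Z + (-1) - i%:Z) (iter_bounded b1 tV v a w)).
    have fL2 : fin (fun i => Y2 (Y v (0 + i%:Z) a) (n%:Z + (-1) - i%:Z) (f w)).
      exact: (bounded_left_fin 0 (fun i => n%:Z + (-1) - i%:Z) (iter_bounded b2 tV v a (f w))).
    rewrite /L1 /L2 /iter_term /iterate_modes lin_isum //; last exact: finZ.
    rewrite -isumB; [|by apply: lin_fin => //; exact: finZ|exact: finZ].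
    (* The modes occurring are [n - 1 - i]: nonnegative for [i < n], where [f] commutes, and with
       zero coefficient for [i > n]. Only the mode [-1] at [i = n] contributes. *)
    rewrite (@isum_single _ _ n) => [|i ni].
      rewrite binz_nat binn !scale1r add0r /g.
      by have -> : n%:Z + -1 - n%:Z = -1 by lia.
    case: (ltngtP i n) ni => // ni _; last by rewrite binz_small ?scale0r ?(lin0 lf) ?subrr.
    by rewrite linZ // hf ?subrr //; lia.
  rewrite -L.
  have -> : L1 = Y1 v n%:Z (Y1 a (-1) w) - Y1 a (-1) (Y1 v n%:Z w).
    by apply/eqP; rewrite -subr_eq0 opprB addrA addrAC J1.
  have -> : L2 = Y2 v n%:Z (Y2 a (-1) (f w)) - Y2 a (-1) (Y2 v n%:Z (f w)).
    by apply/eqP; rewrite -subr_eq0 opprB addrA addrAC J2.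
  rewrite (linB lf) hf // -[Y2 v n%:Z (f w)]hf //.
  rewrite (@g_hom_mode_of_nonneg _ _ _ Y vac Y1 Y2 f) //.
  by rewrite opprB addrA subrK -(linB (bilin_linr v n%:Z b2)).
have g0 w a : g w a = 0.
  have gv : g w vac = 0 by rewrite /g v1 v2 /= subrr.
  have hgV u m b : g w (Y u m b) = Y2 u m (g w b).
    apply/eqP; rewrite -subr_eq0; apply/eqP.
    apply: (in_span_eq0 (f := fun b => g w (Y u m b) - Y2 u m (g w b)) _ _ (full b)).
      move=> k x y; rewrite (proj2 bV) !lg (proj2 b2).
      by rewrite opprD addrACA -scalerBr.
    move=> _ [v [c [q [q0 ->]]]].
    by rewrite (@g_hom_mode_of_nonneg _ _ _ Y vac Y Y2 (g w)) ?subrr.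
  by rewrite -[a]creation hgV gv (lin0 (bilin_linr _ _ b2)).
split=> // v n w; case: (leP 0 n) => n0; first exact: hf.
have := g0 w (Y v n vac); rewrite /g (vacuum_iterate modV mod1) // (vacuum_iterate modV mod2) //.
by move/eqP; rewrite subr_eq0 => /eqP.
Qed.

Lemma fin2_rows (W : lmodType C) (G : nat -> nat -> W) :
  (exists N : nat, forall i, (N <= i)%N -> forall j, G i j = 0) -> (forall i, fin (G i)) -> fin2 G.
Proof.
move=> [N GN] fG.
have [M HM] : exists M : nat, forall i j, (i < N)%N -> (M <= j)%N -> G i j = 0.
  elim: {GN}N => [|n [M IH]]; first by exists 0%N.
  have [M' HM'] := fG n; exists (maxn M M') => i j; rewrite ltnS leq_eqVlt geq_max.
  by move=> /orP[/eqP ->|ni] /andP[Mj M'j]; [exact: HM'|exact: IH].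
exists (maxn N M) => i j; rewrite !geq_max => H.
by case: (leqP N i) => Ni; [exact: GN|apply: HM => //; lia].
Qed.

Lemma mode_rec_eq0_right (W : lmodType C) (D : int -> int -> int -> W) :
  mode_rec D -> (forall p q, D 0 p q = 0) ->
  (exists B : int, forall r p q, B <= q -> D r p q = 0) -> forall r p q, D r p q = 0.
Proof.
move=> rD D0 [B DB].
apply: (@int_ind_down _ 0) => [r r0 p q|r IHr p q].
  have -> : r = `|r|%N%:Z by lia.
  exact: mode_rec_ge0.
by rewrite (mode_rec_transfer rD IHr (p' := p + q - B) (q' := B)) ?DB //; lia.
Qed.

(** * Difference operators on coefficients in three variables *)

Section DifferenceOperators.
Variable W : lmodType C.
Implicit Type h : int -> int -> int -> W.

(* Multiplication by [x1 - x] and by [x2 - x] on coefficients of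
   [x1^(-a-1) x2^(-b-1) x^(-c-1)]. *)
Definition diff_ac h : int -> int -> int -> W := fun a b c => h (a + 1) b c - h a b (c + 1).
Definition diff_bc h : int -> int -> int -> W := fun a b c => h a (b + 1) c - h a b (c + 1).

Section Domain.
Variables A B : int.

(** The restriction to [A <= a], [B <= b] is harmless because the operators only raise indices; some
    later identities hold only on such a region. *)
Lemma iter_diff_ac_char (S : nat -> int -> int -> int -> W) h P :
  (forall l a b c, A <= a -> B <= b -> S l.+1 a b c = diff_ac (S l) a b c) ->
  (forall a b c, A <= a -> B <= b -> S 0%N a b c = h a b c) ->
  forall a b c, A <= a -> B <= b -> S P a b c = iter P diff_ac h a b c.
Proof.
move=> HS H0; elim: P => [//|P IHP] a b c Aa Bb.
by rewrite HS //= /diff_ac !IHP //; lia.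
Qed.

Lemma iter_diff_bc_char (S : nat -> int -> int -> int -> W) h P :
  (forall l a b c, A <= a -> B <= b -> S l.+1 a b c = diff_bc (S l) a b c) ->
  (forall a b c, A <= a -> B <= b -> S 0%N a b c = h a b c) ->
  forall a b c, A <= a -> B <= b -> S P a b c = iter P diff_bc h a b c.
Proof.
move=> HS H0; elim: P => [//|P IHP] a b c Aa Bb.
by rewrite HS //= /diff_bc !IHP //; lia.
Qed.

Lemma eq_iter_diff_bc h h' P : (forall a b c, A <= a -> B <= b -> h a b c = h' a b c) ->
  forall a b c, A <= a -> B <= b -> iter P diff_bc h a b c = iter P diff_bc h' a b c.
Proof.
by move=> hh'; apply: (@iter_diff_bc_char (fun l => iter l diff_bc h)).
Qed.

End Domain.

Lemma iter_diff_acB h h' P a b c :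
  iter P diff_ac (fun a b c => h a b c - h' a b c) a b c = iter P diff_ac h a b c - iter P diff_ac h' a b c.
Proof.
elim: P a b c => [//|P IHP] a b c; rewrite /= {1}/diff_ac !IHP /diff_ac.
by rewrite !opprD !opprK addrACA.
Qed.

(** The bound may vary with [c] but not with [r], as the descent in [r] requires. *)
Definition bounded_mid (R : Type) (h : R -> int -> int -> int -> W) :=
  forall c, exists B : int, forall r a b, B <= b -> h r a b c = 0.

Lemma bounded_mid_diff_ac R (h : R -> int -> int -> int -> W) P :
  bounded_mid h -> bounded_mid (fun r => iter P diff_ac (h r)).
Proof.
move=> bh; elim: P => [//|P IHP] c.
have [B HB] := IHP c; have [B' HB'] := IHP (c + 1).
by exists (`|B|%N + `|B'|%N)%N%:Z => r a b Bb; rewrite /= /diff_ac HB ?HB' ?subr0 //; lia.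
Qed.

Lemma bounded_mid_diff_bc R (h : R -> int -> int -> int -> W) P :
  bounded_mid h -> bounded_mid (fun r => iter P diff_bc (h r)).
Proof.
move=> bh; elim: P => [//|P IHP] c.
have [B HB] := IHP c; have [B' HB'] := IHP (c + 1).
by exists (`|B|%N + `|B'|%N)%N%:Z => r a b Bb; rewrite /= /diff_bc HB ?HB' ?subr0 //; lia.
Qed.

Lemma iter_diff_ac_rec (h : int -> int -> int -> int -> W) P :
  (forall c, mode_rec (fun r a b => h r a b c)) ->
  forall c, mode_rec (fun r a b => iter P diff_ac (h r) a b c).
Proof.
move=> rh; elim: P => [//|P IHP] c r a b /=; rewrite /diff_ac !(IHP (c + 1)) !(IHP c).
by rewrite !opprD !opprK addrACA.
Qed.

Lemma iter_diff_bc_rec (h : int -> int -> int -> int -> W) P :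
  (forall c, mode_rec (fun r a b => h r a b c)) ->
  forall c, mode_rec (fun r a b => iter P diff_bc (h r) a b c).
Proof.
move=> rh; elim: P => [//|P IHP] c r a b /=; rewrite /diff_bc !(IHP (c + 1)) !(IHP c).
by rewrite !opprD !opprK addrACA.
Qed.

End DifferenceOperators.

Lemma eq_subD (U : zmodType) (a b c d : U) : b = d -> a = c -> a = b + c - d.
Proof. by move=> -> ->; rewrite addrAC subrr add0r. Qed.

(** * Vanishing of the defect on the vectors [v_n w1] *)

Section CommutatorOperator.
Variables (V W1 W2 W3 : lmodType C) (Y : V -> int -> V -> V) (vac : V).
Variables (Y1 : V -> int -> W1 -> W1) (Y2 : V -> int -> W2 -> W2) (Y3 : V -> int -> W3 -> W3).

(** Integer modes and the commutator formula: the structure that the defect inherits from the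
    operator it comes from. *)
Definition commutator_op (I : W1 -> int -> W2 -> W3) :=
  [/\ bilin I, truncated I &
      forall v w1 w2 p q, jacobi_defect Y1 Y2 Y3 I v w1 w2 0 p q = 0].

Hypotheses (modV : weak_module Y vac Y).
Hypotheses (mod1 : weak_module Y vac Y1) (mod2 : weak_module Y vac Y2) (mod3 : weak_module Y vac Y3).
Variable I : W1 -> int -> W2 -> W3.
Hypothesis commI : commutator_op I.

Let bV : bilin Y. Proof. by case: modV. Qed.
Let b1 : bilin Y1. Proof. by case: mod1. Qed.
Let b2 : bilin Y2. Proof. by case: mod2. Qed.
Let b3 : bilin Y3. Proof. by case: mod3. Qed.
Let tV : truncated Y. Proof. by case: modV. Qed.
Let t1 : truncated Y1. Proof. by case: mod1. Qed.
Let t2 : truncated Y2. Proof. by case: mod2. Qed.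
Let t3 : truncated Y3. Proof. by case: mod3. Qed.
Let bI : bilin I. Proof. by case: commI. Qed.
Let tI : truncated I. Proof. by case: commI. Qed.

Lemma commutator v w1 w2 p q :
  iter_term Y1 I v w1 w2 0 p q = Y3 v p (I w1 q w2) - I w1 q (Y2 v p w2).
Proof.
have [_ _ /(_ v w1 w2 p q)] := commI.
rewrite /jacobi_defect /left_term /right_term !product_modes0 expr0z scale1r => /eqP.
by rewrite -addrA addr_eq0 opprD opprK => /eqP.
Qed.

Section FixedVectors.
Variables (u v : V) (w1 : W1) (w2 : W2).

(* Coefficients of [x2^(-b-1) x^(-c-1)] in [(x2 - x)^k [v(x2), I(x)] w2]
   and of [x1^(-a-1) x^(-c-1)] in [(x1 - x)^l [u(x1), I(x)] w2], for [k, l >= 0]. *)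
Definition inner_iterate (k b c : int) : W3 := iter_term Y1 I v w1 w2 k b c.
Definition u_iterate (l a c : int) : W3 := iter_term Y1 I u w1 w2 l a c.

Lemma inner_iterate_bounded (k : nat) b c : exists N : nat, forall i : nat, (N <= i)%N -> inner_iterate k%:Z b (c + i%:Z) = 0.
Proof.
elim: k b c => [|k IHk] b c.
  have [N HN] := tI w1 w2; have [N' HN'] := tI w1 (Y2 v b w2).
  have [M HM] := int_index N c; have [M' HM'] := int_index N' c.
  exists (maxn M M') => i; rewrite geq_max => /andP[/HM Mi /HM' M'i].
  by rewrite /inner_iterate commutator HN ?HN' // (lin0 (bilin_linr _ _ b3)) subrr.
have [N HN] := IHk (b + 1) c; have [N' HN'] := IHk b (c + 1).
exists (maxn N N') => i; rewrite geq_max => /andP[Ni N'i].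
have -> : k.+1%:Z = k%:Z + 1 by lia.
rewrite /inner_iterate (iter_rec bI t1) [X in X - _]HN //.
have -> : c + i%:Z + 1 = c + 1 + i%:Z by lia.
by rewrite [X in _ - X]HN' // subr0.
Qed.

Lemma inner_iterate_bounded_mid c : exists B : int, forall b, B <= b ->
  forall (k i : nat), inner_iterate k%:Z b (c + i%:Z) = 0.
Proof.
have [N HN] := tI w1 w2; have [M HM] := int_index N c.
have [B HB] : exists B : int, forall b, B <= b -> forall i : nat, (i < M)%N -> Y3 v b (I w1 (c + i%:Z) w2) = 0.
  elim: {HM}M => [|M [B IH]]; first by exists 0.
  have [B' HB'] := t3 v (I w1 (c + M%:Z) w2).
  exists (`|B|%N + `|B'|%N)%N%:Z => b Bb i; rewrite ltnS leq_eqVlt => /orP[/eqP ->|iM].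
    by apply: HB'; lia.
  by apply: IH => //; lia.
have [B' HB'] := t2 v w2.
exists (`|B|%N + `|B'|%N)%N%:Z => b Bb k; elim: k b Bb => [|k IHk] b Bb i.
  rewrite /inner_iterate commutator HB'; last lia.
  rewrite (lin0 (bilin_linr _ _ bI)) subr0.
  case: (ltnP i M) => iM; first by apply: HB => //; lia.
  by rewrite HN ?HM // (lin0 (bilin_linr _ _ b3)).
have -> : k.+1%:Z = k%:Z + 1 by lia.
rewrite /inner_iterate (iter_rec bI t1) [X in X - _]IHk; last lia.
have -> : c + i%:Z + 1 = c + i.+1%:Z by lia.
by rewrite [X in _ - X]IHk // subr0.
Qed.

Lemma inner_iterate_large : exists N : nat, forall k : nat, (N <= k)%N -> forall b c, inner_iterate k%:Z b c = 0.
Proof.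
have [N HN] := t1 v w1; exists `|N|%N => k Nk b c.
rewrite /inner_iterate /iter_term /iterate_modes isum_eq0 // => i.
by rewrite HN ?(lin0 (bilin_linl _ _ bI)) ?scaler0 //; lia.
Qed.

(* [(x1 - x)^l (x2 - x)^k u(x1) [v(x2), I(x)] w2], expanded in nonnegative powers of [x]. *)
Definition outer_product (l : int) (k : nat) (a b c : int) : W3 := product_modes (fun a c => Y3 u a (inner_iterate k%:Z b c)) l a c.

Lemma outer_product_bounded k b c : bounded_right (fun a c => Y3 u a (inner_iterate k%:Z b c)) c.
Proof.
have [N HN] := inner_iterate_bounded k b c; exists N => i /HN -> a.
exact: lin0 (bilin_linr _ _ b3).
Qed.

Lemma outer_product_rec_ac l k a b c : outer_product (l + 1) k a b c = outer_product l k (a + 1) b c - outer_product l k a b (c + 1).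
Proof. by rewrite /outer_product product_modes_rec //; exact: outer_product_bounded. Qed.

Lemma outer_product_rec_bc l k a b c : outer_product l k.+1 a b c = outer_product l k a (b + 1) c - outer_product l k a b (c + 1).
Proof.
rewrite /outer_product /product_modes -isumB; first last.
- apply: finZ; exact: (bounded_right_fin (fun i => a + l - i%:Z) (outer_product_bounded k b (c + 1))).
- apply: finZ; exact: (bounded_right_fin (fun i => a + l - i%:Z) (outer_product_bounded k (b + 1) c)).
apply: eq_isum => i; have -> : k.+1%:Z = k%:Z + 1 by lia.
rewrite /inner_iterate (iter_rec bI t1) (linB (bilin_linr _ _ b3)) scalerBr.
by have -> : c + i%:Z + 1 = c + 1 + i%:Z by lia.
Qed.

Lemma outer_product0 k a b c : outer_product 0 k a b c = Y3 u a (inner_iterate k%:Z b c).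
Proof. by rewrite /outer_product product_modes0. Qed.

Variables (P m : nat).
Hypothesis uP : forall i : nat, Y1 u (P%:Z + i%:Z) w1 = 0.

(* Multiplication by [(x1 - x2)^r], written as [((x1 - x) - (x2 - x))^r]; the sum is
   finite because a power of [x2 - x] kills the commutator. *)
Definition commutator_sum (r a b c : int) : W3 := isum (fun k : nat => sbin r k *: outer_product (P%:Z + r - k%:Z) (m + k) a b c).

Lemma commutator_sum_fin (f : nat -> int) a b c : fin (fun k : nat => outer_product (f k) (m + k) a b c).
Proof.
have [N HN] := inner_iterate_large; exists N => k Nk; rewrite /outer_product /product_modes isum_eq0 // => i.
by rewrite HN ?(lin0 (bilin_linr _ _ b3)) ?scaler0 //; lia.
Qed.

(** Multiplication by [x1 - x2] is the difference of those by [x1 - x] and [x2 - x]; their shifts of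
    [c] cancel. *)
Lemma commutator_sum_rec c : mode_rec (fun r a b => commutator_sum r a b c).
Proof.
move=> r a b; rewrite /commutator_sum isum_sbin_pascal; last exact: (commutator_sum_fin (fun k => P%:Z + (r + 1) - k%:Z)).
rewrite -!isumB; try (apply: finZ).
- apply: eq_isum => k; rewrite -!scalerBr; congr (_ *: _).
  have -> : P%:Z + (r + 1) - k%:Z = (P%:Z + r - k%:Z) + 1 by lia.
  have -> : P%:Z + (r + 1) - k.+1%:Z = P%:Z + r - k%:Z by lia.
  by rewrite outer_product_rec_ac addnS outer_product_rec_bc opprB addrA subrK.
- exact: (commutator_sum_fin (fun k => P%:Z + r - k%:Z)).
- exact: (commutator_sum_fin (fun k => P%:Z + r - k%:Z)).
- exact: (commutator_sum_fin (fun k => P%:Z + (r + 1) - k%:Z)).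
- have [N HN] := commutator_sum_fin (fun k => P%:Z + (r + 1) - k%:Z) a b c.
  by exists N => k Nk; apply: (HN k.+1); lia.
Qed.

Lemma commutator_sum_bounded_mid : bounded_mid commutator_sum.
Proof.
move=> c; have [B HB] := inner_iterate_bounded_mid c; exists B => r a b Bb.
rewrite /commutator_sum isum_eq0 // => k; rewrite /outer_product /product_modes isum_eq0 ?scaler0 // => i.
by rewrite HB // (lin0 (bilin_linr _ _ b3)) scaler0.
Qed.

(* [(x1 - x2)^r [u(x1) v(x2), I(x)] w2], expanded in nonnegative powers of [x2]. *)
Definition uv_commutator (r a b c : int) : W3 :=
  left_term Y3 Y3 u v (I w1 c w2) r a b - I w1 c (left_term Y2 Y2 u v w2 r a b).

Lemma uv_commutator_rec c : mode_rec (fun r a b => uv_commutator r a b c).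
Proof.
move=> r a b; rewrite /uv_commutator (left_rec b3 t3) (left_rec b2 t2) (linB (bilin_linr _ _ bI)).
by rewrite !opprD !opprK addrACA.
Qed.

Lemma uv_commutator_bounded_mid : bounded_mid uv_commutator.
Proof.
move=> c; have [B HB] := t3 v (I w1 c w2); have [B' HB'] := t2 v w2.
exists (`|B|%N + `|B'|%N)%N%:Z => r a b Bb.
rewrite /uv_commutator /left_term /product_modes !isum_eq0 ?(lin0 (bilin_linr _ _ bI)) ?subr0 // => i.
  by rewrite HB' ?(lin0 (bilin_linr _ _ b2)) ?scaler0 //; lia.
by rewrite HB ?(lin0 (bilin_linr _ _ b3)) ?scaler0 //; lia.
Qed.

Lemma u_iterate_vanishes w a c : iter_term Y1 I u w1 w P%:Z a c = 0.
Proof.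
rewrite /iter_term /iterate_modes isum_eq0 // => i.
by rewrite uP (lin0 (bilin_linl _ _ bI)) scaler0.
Qed.

(** Since [[uv, I] = u [v, I] + [u, I] v], the two sides differ by a multiple of [(x1 - x)^P
    [u(x1), I(x)]], which is zero. *)
Lemma commutator_sum0 a b c : commutator_sum 0 a b c = iter m (@diff_bc W3) (iter P (@diff_ac W3) (uv_commutator 0)) a b c.
Proof.
rewrite /commutator_sum isum_sbin0 addn0 (_ : _ - _ = P%:Z); last lia.
have RT2 : outer_product P%:Z m a b c = iter m (@diff_bc W3) (outer_product P%:Z 0) a b c.
  apply: (@iter_diff_bc_char _ a b (fun k => outer_product P%:Z k)) => // l a' b' c' _ _.
  exact: outer_product_rec_bc.
have RT1 a' b' c' : outer_product P%:Z 0 a' b' c' = iter P (@diff_ac W3) (outer_product 0 0) a' b' c'.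
  apply: (@iter_diff_ac_char _ a' b' (fun l => outer_product l%:Z 0)) => // l x y z _ _.
  have -> : l.+1%:Z = l%:Z + 1 by lia.
  exact: outer_product_rec_ac.
rewrite RT2; apply: (@eq_iter_diff_bc _ a b) => // a' b' c' _ _.
rewrite RT1; apply/eqP; rewrite -subr_eq0 -iter_diff_acB; apply/eqP.
pose S (l : nat) a b c := - iter_term Y1 I u w1 (Y2 v b w2) l%:Z a c.
rewrite -(@iter_diff_ac_char _ a' b' S) //; first by rewrite /S u_iterate_vanishes oppr0.
- move=> l x y z _ _; rewrite /S /diff_ac; have -> : l.+1%:Z = l%:Z + 1 by lia.
  by rewrite (iter_rec bI t1) opprB opprK addrC.
move=> x y z _ _; rewrite /S outer_product0 /inner_iterate /uv_commutator !commutator /left_term !product_modes0.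
by rewrite (linB (bilin_linr _ _ b3)) !opprB [RHS]addrC addrA subrK.
Qed.

(* Both sides satisfy the recursion for multiplication by [x1 - x2], vanish for large
   [b], and agree for [r = 0] because [(x1 - x)^P] kills [[u(x1), I(x)]]. *)
Lemma commutator_sumE r a b c : commutator_sum r a b c = iter m (@diff_bc W3) (iter P (@diff_ac W3) (uv_commutator r)) a b c.
Proof.
pose D r a b := commutator_sum r a b c - iter m (@diff_bc W3) (iter P (@diff_ac W3) (uv_commutator r)) a b c.
suff D0 : forall r a b, D r a b = 0 by apply/eqP; rewrite -subr_eq0; apply/eqP/D0.
apply: mode_rec_eq0_right.
- move=> r' p q; rewrite /D commutator_sum_rec.
  rewrite (@iter_diff_bc_rec _ (fun r => iter P (@diff_ac W3) (uv_commutator r))); last first.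
    by move=> c'; apply: iter_diff_ac_rec => c''; exact: uv_commutator_rec.
  by rewrite !opprD !opprK addrACA.
- by move=> p q; rewrite /D commutator_sum0 subrr.
have [B HB] := commutator_sum_bounded_mid c.
have [B' HB'] := bounded_mid_diff_bc m (bounded_mid_diff_ac P uv_commutator_bounded_mid) c.
exists (`|B|%N + `|B'|%N)%N%:Z => r' p q Bq.
by rewrite /D HB ?HB' ?subrr //; lia.
Qed.

Hypothesis (A : int).
Hypothesis uA : forall a, A <= a -> Y2 u a w2 = 0.

Lemma right_term_top r a b : A <= a -> right_term Y2 Y2 u v w2 r a b = 0.
Proof.
move=> Aa; rewrite /right_term /product_modes isum_eq0 ?scaler0 // => i.
by rewrite uA ?(lin0 (bilin_linr _ _ b2)) ?scaler0 //; lia.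
Qed.

(* [(-x2 + x1)^r v(x2) u(x1) I(x) w2], expanded in nonnegative powers of [x1]. *)
Definition reversed_product (r a b c : int) : W3 := right_term Y3 Y3 u v (I w1 c w2) r a b.

Lemma u_iterate_bounded (l : nat) a c : exists N : nat, forall i : nat, (N <= i)%N -> u_iterate l%:Z (a + i%:Z) c = 0.
Proof.
elim: l a c => [|l IHl] a c.
  have [N HN] := t3 u (I w1 c w2); have [N' HN'] := t2 u w2.
  have [M HM] := int_index N a; have [M' HM'] := int_index N' a.
  exists (maxn M M') => i; rewrite geq_max => /andP[/HM Mi /HM' M'i].
  by rewrite /u_iterate commutator HN ?HN' // (lin0 (bilin_linr _ _ bI)) subrr.
have [N HN] := IHl (a + 1) c; have [N' HN'] := IHl a (c + 1).
exists (maxn N N') => i; rewrite geq_max => /andP[Ni N'i].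
have -> : l.+1%:Z = l%:Z + 1 by lia.
rewrite /u_iterate (iter_rec bI t1) [X in _ - X]HN' //.
have -> : a + i%:Z + 1 = a + 1 + i%:Z by lia.
by rewrite [X in X - _]HN // subr0.
Qed.

(* On [a >= A] the operator [u_a] kills [w2], so [u_a I_c w2] is a commutator,
   which is annihilated by [(x1 - x)^P]. *)
Lemma reversed_product_vanishes r a b c : A <= a -> iter P (@diff_ac W3) (reversed_product r) a b c = 0.
Proof.
move=> Aa.
pose S (l : nat) a b c := (-1 : C) ^ r *: product_modes (fun b a => Y3 v b (u_iterate l%:Z a c)) r b a.
have Sb (l : nat) a' c' : bounded_right (fun b a => Y3 v b (u_iterate l%:Z a c')) a'.
  have [N HN] := u_iterate_bounded l a' c'; exists N => i /HN -> x.
  exact: lin0 (bilin_linr _ _ b3).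
rewrite -(@iter_diff_ac_char _ A b S) // /S.
- rewrite /product_modes isum_eq0 ?scaler0 // => i.
  by rewrite /u_iterate u_iterate_vanishes (lin0 (bilin_linr _ _ b3)) scaler0.
- move=> l x y z Ax _; rewrite /diff_ac -scalerBr; congr (_ *: _).
  rewrite /product_modes -isumB; first last.
  + apply: finZ; exact: (bounded_right_fin (fun i => y + r - i%:Z) (Sb l x (z + 1))).
  + apply: finZ; exact: (bounded_right_fin (fun i => y + r - i%:Z) (Sb l (x + 1) z)).
  apply: eq_isum => i; rewrite -scalerBr -(linB (bilin_linr _ _ b3)).
  have -> : l.+1%:Z = l%:Z + 1 by lia.
  rewrite /u_iterate (iter_rec bI t1).
  by have -> : x + i%:Z + 1 = x + 1 + i%:Z by lia.
move=> x y z Ax _; rewrite /reversed_product /right_term /product_modes; congr (_ *: _); apply: eq_isum => i.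
rewrite /u_iterate commutator uA; last lia.
by rewrite (lin0 (bilin_linr _ _ bI)) subr0.
Qed.

Definition uv_iterate (r l k : int) : W1 := iter_term Y Y1 u v w1 r l k.

(* With [x1 = x + (x1 - x)] and [x2 = x + (x2 - x)], the coefficients of
   [(x1 - x)^l (x2 - x)^k [Y(Y(u, x1 - x2) v, x2), I(x)] w2], where the inner
   iterate contributes the factor [(x1 - x2)^r]. *)
Definition iterate_sum (r : int) (l k : nat) (a b c : int) : W3 :=
  isum (fun t => isum (fun j => (binz a t * binz b j) *:
    I (uv_iterate r (l + t)%N%:Z (k + j)%N%:Z) (a + b + c - t%:Z - j%:Z) w2)).

Lemma uv_iterate_bound r : exists N : nat, forall l k : nat, (N <= l)%N || (N <= k)%N -> uv_iterate r l%:Z k%:Z = 0.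
Proof.
have [N0 HN0] := tV u v; have [M HM] := int_index N0 r.
have Yz n : Y1 0 n w1 = 0 by exact: lin0 (bilin_linl n w1 b1).
have [N HN] : exists N : int, forall i : nat, (i < M)%N -> forall n, N <= n -> Y1 (Y u (r + i%:Z) v) n w1 = 0.
  elim: {HM}M => [|M [N IH]]; first by exists 0.
  have [N' HN'] := t1 (Y u (r + M%:Z) v) w1.
  exists (`|N|%N + `|N'|%N)%N%:Z => i; rewrite ltnS leq_eqVlt => /orP[/eqP ->|iM] n Nn.
    by apply: HN'; lia.
  by apply: IH => //; lia.
exists (M + `|N|)%N => l k lk; rewrite /uv_iterate /iter_term /iterate_modes isum_eq0 // => i.
case: (ltnP i M) => iM; last by rewrite HN0 ?HM // Yz scaler0.
case: (leqP i l) => il; last by rewrite binz_small ?scale0r.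
by rewrite HN ?scaler0 //; lia.
Qed.

Lemma iterate_sum_fin2 r l k (f : nat -> nat -> int) :
  fin2 (fun t j => I (uv_iterate r (l + t)%N%:Z (k + j)%N%:Z) (f t j) w2).
Proof.
have [N HN] := uv_iterate_bound r; exists N => t j tj.
by rewrite HN ?(lin0 (bilin_linl _ _ bI)) //; lia.
Qed.

Lemma iterate_sum_row r l k a b c : iterate_sum r l k a b c =
  isum (fun t => binz a t *: isum (fun j => binz b j *:
    I (uv_iterate r (l + t)%N%:Z (k + j)%N%:Z) (a + b + c - t%:Z - j%:Z) w2)).
Proof.
apply: eq_isum => t; rewrite -isumZ.
  by apply: eq_isum => j; rewrite scalerA.
apply: finZ.
exact: (fin2_row t (iterate_sum_fin2 r l k (fun t j => a + b + c - t%:Z - j%:Z))).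
Qed.

Lemma iterate_sum_col r l k a b c : iterate_sum r l k a b c =
  isum (fun j => binz b j *: isum (fun t => binz a t *:
    I (uv_iterate r (l + t)%N%:Z (k + j)%N%:Z) (a + b + c - t%:Z - j%:Z) w2)).
Proof.
have fX := iterate_sum_fin2 r l k (fun t j => a + b + c - t%:Z - j%:Z).
rewrite /iterate_sum exchange_isum; last exact: (fin2Z (fun t j => binz a t * binz b j) fX).
apply: eq_isum => j; rewrite -isumZ.
  by apply: eq_isum => t; rewrite scalerA [_ * binz a t]mulrC.
by apply: finZ; exact: (fin2_row j (fin2_tr fX)).
Qed.

Lemma iterate_sum_rec_ac r l k a b c : iterate_sum r l.+1 k a b c = diff_ac (iterate_sum r l k) a b c.
Proof.
rewrite /diff_ac !iterate_sum_row isum_binz_pascal; last first.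
  apply: (@fin2_isum _ (fun t j => binz b j *: I (uv_iterate r (l + t)%N%:Z (k + j)%N%:Z) (a + 1 + b + c - t%:Z - j%:Z) w2)).
  exact: (fin2Z (fun _ j => binz b j) (iterate_sum_fin2 r l k (fun t j => a + 1 + b + c - t%:Z - j%:Z))).
apply: eq_subD; apply: eq_isum => t; congr (_ *: _); apply: eq_isum => j; congr (_ *: I _ _ _).
- lia.
- by rewrite addSnnS.
- lia.
Qed.

Lemma iterate_sum_rec_bc r l k a b c : iterate_sum r l k.+1 a b c = diff_bc (iterate_sum r l k) a b c.
Proof.
rewrite /diff_bc !iterate_sum_col isum_binz_pascal; last first.
  apply: (@fin2_isum _ (fun j t => binz a t *: I (uv_iterate r (l + t)%N%:Z (k + j)%N%:Z) (a + (b + 1) + c - t%:Z - j%:Z) w2)).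
  exact: (fin2Z (fun _ t => binz a t) (fin2_tr (iterate_sum_fin2 r l k (fun t j => a + (b + 1) + c - t%:Z - j%:Z)))).
apply: eq_subD; apply: eq_isum => t; congr (_ *: _); apply: eq_isum => j; congr (_ *: I _ _ _).
- lia.
- by rewrite addSnnS.
- lia.
Qed.

Lemma iterate_commutator r (a b c : int) :
  isum (fun i => binz a i *: iter_term Y1 I (Y u (r + i%:Z) v) w1 w2 0 (a + b - i%:Z) c) =
  iter_term Y Y3 u v (I w1 c w2) r a b - I w1 c (iter_term Y Y2 u v w2 r a b).
Proof.
have f3 := bounded_left_fin r (fun i => a + b - i%:Z) (iter_bounded b3 tV u v (I w1 c w2)).
have f2 := bounded_left_fin r (fun i => a + b - i%:Z) (iter_bounded b2 tV u v w2).
have lI := bilin_linr w1 c bI.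
rewrite /(iter_term Y) /iterate_modes (lin_isum lI); last exact: finZ.
rewrite -isumB; [|exact: finZ|by apply: lin_fin => //; exact: finZ].
by apply: eq_isum => i; rewrite commutator scalerBr (linZ lI).
Qed.

(** The commutator formula for each [u_(r + i) v], re-sorted by trinomial revision and Vandermonde.
    The latter wants [p] natural, a range that the differences starting from [b = 0] never leave. *)
Lemma iterate_sum00 r (a c : int) (p : nat) : iterate_sum r 0 0 a p%:Z c =
  iter_term Y Y3 u v (I w1 c w2) r a p%:Z - I w1 c (iter_term Y Y2 u v w2 r a p%:Z).
Proof.
rewrite -iterate_commutator.
pose G (i n : nat) := I (Y1 (Y u (r + i%:Z) v) n%:Z w1) (a + p%:Z + c - i%:Z - n%:Z) w2.
have Iz n : I 0 n w2 = 0 by exact: lin0 (bilin_linl n w2 bI).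
have fG : fin2 G.
  apply: fin2_rows => [|i].
    have [N HN] := tV u v; have [M HM] := int_index N r.
    by exists M => i Mi j; rewrite /G HN ?HM // (lin0 (bilin_linl _ w1 b1)) Iz.
  have [N HN] := t1 (Y u (r + i%:Z) v) w1.
  by exists `|N|%N => n Nn; rewrite /G HN ?Iz //; lia.
transitivity (isum (fun t => isum (fun j => (binz a t * binz p%:Z j) *:
    isum (fun i => binz t%:Z i *: G i (t - i + j)%N)))).
  apply: eq_isum => t; apply: eq_isum => j; congr (_ *: _).
  rewrite /uv_iterate /iter_term /iterate_modes (lin_isum (bilin_linl _ _ bI)); last first.
    by apply: finZ; exact: (bounded_left_fin r (fun i => (0 + t)%N%:Z + (0 + j)%N%:Z - i%:Z) (iter_bounded b1 tV u v w1)).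
  apply: eq_isum => i; rewrite (linZ (bilin_linl _ _ bI)).
  case: (leqP i t) => it; last by rewrite binz_small ?scale0r.
  by rewrite /G; congr (_ *: I (Y1 _ _ _) _ _); lia.
rewrite isum_trinomial_vandermonde //; apply: eq_isum => i.
rewrite /iter_term /iterate_modes -isumZ.
  apply: eq_isum => n; rewrite scalerA /G add0r; congr (_ * binz _ _ *: I _ _ _); lia.
apply: finZ; apply: (bounded_left_fin 0 (fun n => a + p%:Z - i%:Z + c - n%:Z)
  (iter_bounded bI t1 (Y u (r + i%:Z) v) w1 w2)).
Qed.

(** The Jacobi identities of [W3] and [W2] turn iterates into products. For [A <= a] the reversed
    product on [w2] is zero and only the one on [I(x) w2] remains. *)
Lemma iterate_sum00_eq r (a b c : int) : A <= a -> 0 <= b -> iterate_sum r 0 0 a b c = uv_commutator r a b c - reversed_product r a b c.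
Proof.
move=> Aa; case: b => // b _; rewrite iterate_sum00.
have J3 := weak_module_defect tV mod3 u v (I w1 c w2) r a b.
have J2 := weak_module_defect tV mod2 u v w2 r a b.
move: J3 J2; rewrite /jacobi_defect right_term_top // addr0.
move/eqP; rewrite -addrA addr_eq0 opprD opprK => /eqP ->.
move/eqP; rewrite subr_eq0 => /eqP ->.
by rewrite /uv_commutator /reversed_product addrAC.
Qed.

Lemma iterate_sum_top r (a b c : int) : A <= a -> 0 <= b ->
  iterate_sum r P m a b c = iter m (@diff_bc W3) (iter P (@diff_ac W3) (uv_commutator r)) a b c.
Proof.
move=> Aa b0.
rewrite (@iter_diff_bc_char _ A 0 (fun k => iterate_sum r P k) (iter P (@diff_ac W3) (uv_commutator r))) // => [l x y z _ _|x y z Ax y0].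
  exact: iterate_sum_rec_bc.
rewrite (@iter_diff_ac_char _ A 0 (fun l => iterate_sum r l 0) (fun a b c => uv_commutator r a b c - reversed_product r a b c)) //.
- by rewrite iter_diff_acB reversed_product_vanishes // subr0.
- by move=> l x' y' z' _ _; exact: iterate_sum_rec_ac.
- by move=> x' y' z' Ax' y0'; exact: iterate_sum00_eq.
Qed.

(** At [b = 0] only [j = 0] survives. In the Jacobi identity of [W1] the choice of [P] kills the
    reversed product, so the iterates become [u_(P + t + r - k) v_(m + k) w1]. *)
Lemma iterate_sum_iterates r (a c : int) : iterate_sum r P m a 0 c =
  isum (fun k : nat => sbin r k *:
    iter_term Y1 I u (Y1 v (m + k)%N%:Z w1) w2 (P%:Z + r - k%:Z) a c).
Proof.
have Iz n : I 0 n w2 = 0 by exact: lin0 (bilin_linl n w2 bI).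
pose G (t k : nat) := I (Y1 u (P%:Z + t%:Z + r - k%:Z) (Y1 v (m%:Z + k%:Z) w1)) (a + c - t%:Z) w2.
have fG : fin2 G.
  apply/fin2_tr/fin2_rows => [|k].
    have [N HN] := t1 v w1; exists `|N|%N => k Nk t.
    by rewrite /G HN ?(lin0 (bilin_linr _ _ b1)) ?Iz //; lia.
  have [N HN] := t1 u (Y1 v (m%:Z + k%:Z) w1).
  exists (`|N|%N + `|(P%:Z + r - k%:Z)%R|%N)%N => t Nt.
  by rewrite /G HN ?Iz //; lia.
transitivity (isum (fun t => isum (fun k => (binz a t * sbin r k) *: G t k))).
  rewrite iterate_sum_row; apply: eq_isum => t; rewrite isum_binz0.
  have J := weak_module_defect tV mod1 u v w1 r (P + t)%N%:Z m%:Z.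
  have R0 : right_term Y1 Y1 u v w1 r (P + t)%N%:Z m%:Z = 0.
    rewrite /right_term /product_modes isum_eq0 ?scaler0 // => i.
    rewrite (_ : (P + t)%N%:Z + i%:Z = P%:Z + (t + i)%N%:Z); last lia.
    by rewrite uP (lin0 (bilin_linr _ _ b1)) scaler0.
  move/eqP: J; rewrite /jacobi_defect R0 addr0 subr_eq0 => /eqP J.
  rewrite /uv_iterate addn0 J /left_term /product_modes (lin_isum (bilin_linl _ _ bI)); last first.
    by apply: finZ; exact: (bounded_right_fin (fun i => (P + t)%N%:Z + r - i%:Z) (left_bounded b1 t1 u v w1 m%:Z)).
  rewrite -isumZ.
    apply: eq_isum => k; rewrite (linZ (bilin_linl _ _ bI)) scalerA /G.
    by congr (_ *: I (Y1 _ _ _) _ _); lia.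
  exact: (lin_fin (bilin_linl _ w2 bI) (finZ (sbin r)
    (bounded_right_fin (fun i => (P + t)%N%:Z + r - i%:Z) (left_bounded b1 t1 u v w1 m%:Z)))).
rewrite exchange_isum; last exact: (fin2Z (fun t k => binz a t * sbin r k) fG).
apply: eq_isum => k; rewrite /iter_term /iterate_modes -isumZ.
  apply: eq_isum => t; rewrite scalerA [_ * sbin r k]mulrC /G.
  by congr (_ *: I (Y1 _ _ _) _ _); lia.
apply: finZ; exact: (bounded_left_fin (P%:Z + r - k%:Z) (fun t => a + c - t%:Z)
  (iter_bounded bI t1 u (Y1 v (m + k)%N%:Z w1) w2)).
Qed.

(** Both ways of computing the commutator at [b = 0] are equated: one yields iterates of [u] and
    [v_(m + k) w1], the other products of [u] with [I(v_(m + k) w1)]. The third term of each defect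
    is zero for [A <= a]. *)
Lemma defect_sum r (a c : int) : A <= a ->
  isum (fun k : nat => sbin r k *:
    jacobi_defect Y1 Y2 Y3 I u (Y1 v (m + k)%N%:Z w1) w2 (P%:Z + r - k%:Z) a c) = 0.
Proof.
move=> Aa; have E := commutator_sumE r a 0 c; rewrite -iterate_sum_top // iterate_sum_iterates /commutator_sum in E.
rewrite -(subrr (commutator_sum r a 0 c)) {1}/commutator_sum E /commutator_sum -isumB; first last.
- apply: finZ; exact: (commutator_sum_fin (fun k => P%:Z + r - k%:Z)).
- have [N HN] := t1 v w1; exists `|N|%N => k Nk.
  rewrite HN; last lia.
  rewrite /iter_term /iterate_modes isum_eq0 ?scaler0 // => i.
  by rewrite (lin0 (bilin_linr _ _ b1)) (lin0 (bilin_linl _ _ bI)) scaler0.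
apply: eq_isum => k; rewrite -scalerBr; congr (_ *: _).
rewrite /jacobi_defect /right_term /product_modes [X in _ + _ *: X]isum_eq0 => [|i].
  rewrite scaler0 addr0; congr (_ - _).
  by rewrite /outer_product /left_term /product_modes; apply: eq_isum => i; rewrite /inner_iterate /iter_term iterate_modes0.
by rewrite uA ?(lin0 (bilin_linr _ _ bI)) ?scaler0 //; lia.
Qed.

End FixedVectors.

Lemma defect_of_nonneg u v w1 w2 (m : nat) r p q :
  jacobi_defect Y1 Y2 Y3 I u (Y1 v m%:Z w1) w2 r p q = 0.
Proof.
have [N HN] := t1 v w1.
have [P uP] := mode_ge_bound mod1 u w1.
have [A uA] := t2 u w2.
have [_ _ comm0] := commI.
have [n] : exists n : nat, N <= m%:Z + n%:Z by exists `|N|%N; lia.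
elim: n {-2}n (leqnn n) m r p q => [|n0 IH] n nn m r p q Nm.
  rewrite HN; last lia.
  exact: (lin0 (jacobi_defect_lin2 b1 b3 bI t1 t2 tI u w2 r p q)).
apply: mode_rec_eq0; [exact: jacobi_defect_rec|exact: comm0|exists A => {}r {}p {}q Ap].
(* The shift by [P] puts the defect at [r] itself in the term [k = 0]; the terms [k > 0] contain the
   higher modes [v_(m + k) w1] and vanish by induction. *)
have := @defect_sum u v w1 w2 P m uP A uA (r - P%:Z) p q Ap.
rewrite isum_head => [|i].
  rewrite sbin0 scale1r addn0 (_ : P%:Z + (r - P%:Z) - 0%N%:Z = r) //; lia.
rewrite (IH n.-1) ?scaler0 //; lia.
Qed.

End CommutatorOperator.

(** * The defect as an operator on the vertex algebra *)

Lemma subr_subACA (U : zmodType) (a b c d : U) : (a - b) - (c - d) = (a - c) - (b - d).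
Proof. by rewrite !opprD !opprK addrACA. Qed.

Lemma exchange_isum_scale (W : lmodType C) (b d : nat -> C) (G : nat -> nat -> W) : fin2 G ->
  isum (fun i => b i *: isum (fun j => d j *: G i j)) =
  isum (fun j => d j *: isum (fun i => b i *: G i j)).
Proof.
move=> fG.
transitivity (isum (fun i => isum (fun j => (b i * d j) *: G i j))).
  apply: eq_isum => i; rewrite -isumZ; last by apply: finZ; exact: fin2_row i fG.
  by apply: eq_isum => j; rewrite scalerA.
rewrite exchange_isum; last exact: (fin2Z (fun i j => b i * d j)).
apply: eq_isum => j; rewrite -isumZ; last by apply: finZ; exact: fin2_row j (fin2_tr fG).
by apply: eq_isum => i; rewrite scalerA mulrC.
Qed.

Lemma fin2B (W : lmodType C) (G G' : nat -> nat -> W) :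
  fin2 G -> fin2 G' -> fin2 (fun i j => G i j - G' i j).
Proof.
move=> [N GN] [N' GN']; exists (maxn N N') => i j; rewrite !geq_max => H.
by rewrite GN ?GN' ?subrr //; lia.
Qed.

Section DefectOperator.
Variables (V W1 W2 W3 : lmodType C) (Y : V -> int -> V -> V) (vac : V).
Variables (Y1 : V -> int -> W1 -> W1) (Y2 : V -> int -> W2 -> W2) (Y3 : V -> int -> W3 -> W3).
Hypotheses (modV : weak_module Y vac Y).
Hypotheses (mod1 : weak_module Y vac Y1) (mod2 : weak_module Y vac Y2) (mod3 : weak_module Y vac Y3).
Variable I : W1 -> int -> W2 -> W3.
Hypothesis commI : commutator_op Y1 Y2 Y3 I.

Let bV : bilin Y. Proof. by case: modV. Qed.
Let b1 : bilin Y1. Proof. by case: mod1. Qed.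
Let b2 : bilin Y2. Proof. by case: mod2. Qed.
Let b3 : bilin Y3. Proof. by case: mod3. Qed.
Let tV : truncated Y. Proof. by case: modV. Qed.
Let t1 : truncated Y1. Proof. by case: mod1. Qed.
Let t2 : truncated Y2. Proof. by case: mod2. Qed.
Let t3 : truncated Y3. Proof. by case: mod3. Qed.
Let bI : bilin I. Proof. by case: commI. Qed.
Let tI : truncated I. Proof. by case: commI. Qed.

Lemma weak_module_commutator (W : lmodType C) (YW : V -> int -> W -> W) u v w p q :
  weak_module Y vac YW ->
  iter_term Y YW u v w 0 p q = YW u p (YW v q w) - YW v q (YW u p w).
Proof.
move=> modW; apply: commutator; split; try by case: modW.
by move=> *; exact: weak_module_defect tV modW _ _ _ _ _ _.
Qed.

(** Bracketing with [u_k] acts as a derivation on the iterate: the commutator formula for [I]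
    produces [u_j v_(r + i) w1], and moving [u_j] past [v_(r + i)] in [W1] leaves one sum for
    [u_j v] and one for [u_j w1]. *)
Lemma iter_term_bracket u v w1 w2 (r k c : int) (p : nat) :
  Y3 u k (iter_term Y1 I v w1 w2 r p%:Z c) - iter_term Y1 I v w1 (Y2 u k w2) r p%:Z c =
  isum (fun j => binz k j *: iter_term Y1 I (Y u j%:Z v) w1 w2 r (p%:Z + k - j%:Z) c) +
  isum (fun j => binz k j *: iter_term Y1 I v (Y1 u j%:Z w1) w2 r p%:Z (k + c - j%:Z)).
Proof.
have Iz n : I 0 n w2 = 0 by exact: lin0 (bilin_linl n w2 bI).
have [N1 HN1] := tV u v; have [N2 HN2] := t1 u w1.
have [N3 HN3] := t1 v w1; have [M3 HM3] := int_index N3 r.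
pose F1 (i j : nat) := I (Y1 u j%:Z (Y1 v (r + i%:Z) w1)) (k + p%:Z + c - i%:Z - j%:Z) w2.
pose F2 (i j : nat) := I (Y1 v (r + i%:Z) (Y1 u j%:Z w1)) (k + p%:Z + c - i%:Z - j%:Z) w2.
pose G (t n : nat) := I (Y1 (Y u t%:Z v) (r + n%:Z) w1) (k + p%:Z + c - t%:Z - n%:Z) w2.
have fF1 : fin2 F1.
  apply: fin2_rows => [|i].
    by exists M3 => i Mi j; rewrite /F1 HN3 ?HM3 // (lin0 (bilin_linr _ _ b1)) Iz.
  have [N HN] := t1 u (Y1 v (r + i%:Z) w1).
  by exists `|N|%N => j Nj; rewrite /F1 HN ?Iz //; lia.
have fF2 : fin2 F2.
  apply/fin2_tr/fin2_rows => [|j].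
    by exists `|N2|%N => j Mj i; rewrite /F2 HN2 ?(lin0 (bilin_linr _ _ b1)) ?Iz //; lia.
  have [N HN] := t1 v (Y1 u j%:Z w1); have [M HM] := int_index N r.
  by exists M => i /HM Ni; rewrite /F2 HN ?Iz.
have fG : fin2 G.
  apply: fin2_rows => [|i].
    by exists `|N1|%N => i Mi n; rewrite /G HN1 ?(lin0 (bilin_linl _ _ b1)) ?Iz //; lia.
  have [N HN] := t1 (Y u i%:Z v) w1; have [M HM] := int_index N r.
  by exists M => n /HM Nn; rewrite /G HN ?Iz.
have fv w := bounded_left_fin r (fun i => p%:Z + c - i%:Z) (iter_bounded bI t1 v w1 w).
have -> : Y3 u k (iter_term Y1 I v w1 w2 r p%:Z c) - iter_term Y1 I v w1 (Y2 u k w2) r p%:Z c =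
    isum (fun i => binz p%:Z i *: isum (fun j => binz k j *: F1 i j)).
  rewrite /(iter_term Y1 I v) /iterate_modes (lin_isum (bilin_linr _ _ b3)); last exact: finZ.
  rewrite -isumB; [|apply: (lin_fin (bilin_linr _ _ b3)); exact: finZ|exact: finZ].
  apply: eq_isum => i; rewrite (linZ (bilin_linr _ _ b3)) -scalerBr; congr (_ *: _).
  rewrite -(commutator commI) /iter_term /iterate_modes; apply: eq_isum => j.
  by rewrite /F1; congr (_ *: I (Y1 _ _ _) _ _); lia.
have F12 i j : F1 i j - F2 i j = isum (fun t => binz j%:Z t *: G t (j - t + i)%N).
  rewrite /F1 /F2 -(linB (bilin_linl _ _ bI)) -weak_module_commutator //.
  rewrite /iter_term /iterate_modes (lin_isum (bilin_linl _ _ bI)); last first.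
    by apply: finZ; exact: (bounded_left_fin 0 (fun t => j%:Z + (r + i%:Z) - t%:Z) (iter_bounded b1 tV u v w1)).
  apply: eq_isum => t; rewrite (linZ (bilin_linl _ _ bI)).
  case: (leqP t j) => tj; last by rewrite binz_small ?scale0r.
  by rewrite /G add0r; congr (_ *: I (Y1 _ _ _) _ _); lia.
have -> : isum (fun j => binz k j *: iter_term Y1 I v (Y1 u j%:Z w1) w2 r p%:Z (k + c - j%:Z)) =
    isum (fun i => binz p%:Z i *: isum (fun j => binz k j *: F2 i j)).
  rewrite exchange_isum_scale //; apply: eq_isum => j; congr (_ *: _).
  rewrite /iter_term /iterate_modes; apply: eq_isum => i.
  by rewrite /F2; congr (_ *: I (Y1 _ _ _) _ _); lia.
apply/eqP; rewrite -subr_eq; apply/eqP.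
rewrite -isumB; first last.
- have [M HM] := fF2; exists M => i Mi; rewrite isum_eq0 ?scaler0 // => j.
  by rewrite HM ?Mi // scaler0.
- have [M HM] := fF1; exists M => i Mi; rewrite isum_eq0 ?scaler0 // => j.
  by rewrite HM ?Mi // scaler0.
transitivity (isum (fun i => binz p%:Z i *: isum (fun j => binz k j *: (F1 i j - F2 i j)))).
  apply: eq_isum => i; rewrite -scalerBr -isumB; first last.
  - by apply: finZ; exact: fin2_row i fF2.
  - by apply: finZ; exact: fin2_row i fF1.
  by congr (_ *: _); apply: eq_isum => j; rewrite scalerBr.
rewrite exchange_isum_scale; last exact: fin2B.
transitivity (isum (fun j => isum (fun i => (binz k j * binz p%:Z i) *:
    isum (fun t => binz j%:Z t *: G t (j - t + i)%N)))).
  apply: eq_isum => j; rewrite -isumZ; last by apply: finZ; exact: (fin2_row j (fin2_tr (fin2B fF1 fF2))).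
  by apply: eq_isum => i; rewrite scalerA F12.
rewrite isum_trinomial_vandermonde //; apply: eq_isum => t.
rewrite /iter_term /iterate_modes -isumZ.
  apply: eq_isum => n; rewrite scalerA /G.
  by congr (_ * binz _ _ *: I _ _ _); lia.
apply: finZ; exact: (bounded_left_fin r (fun n => p%:Z + k - t%:Z + c - n%:Z)
  (iter_bounded bI t1 (Y u t%:Z v) w1 w2)).
Qed.

(** The same derivation rule for the product, from [[u, v I] = [u, v] I + v [u, I]]. Having it for
    both terms passes it on to their difference. *)
Lemma left_term_bracket u v w1 w2 (r k p c : int) :
  Y3 u k (left_term Y3 I v w1 w2 r p c) - left_term Y3 I v w1 (Y2 u k w2) r p c =
  isum (fun j => binz k j *: left_term Y3 I (Y u j%:Z v) w1 w2 r (p + k - j%:Z) c) +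
  isum (fun j => binz k j *: left_term Y3 I v (Y1 u j%:Z w1) w2 r p (k + c - j%:Z)).
Proof.
have Iz n : I 0 n w2 = 0 by exact: lin0 (bilin_linl n w2 bI).
have Yz n x : Y3 x n 0 = 0 by exact: lin0 (bilin_linr x n b3).
have [N1 HN1] := tV u v; have [N2 HN2] := t1 u w1.
have [N3 HN3] := tI w1 w2; have [M3 HM3] := int_index N3 c.
pose F1 (i j : nat) := Y3 (Y u j%:Z v) (k + p + r - i%:Z - j%:Z) (I w1 (c + i%:Z) w2).
pose F2 (i j : nat) := Y3 v (p + r - i%:Z) (I (Y1 u j%:Z w1) (k + c + i%:Z - j%:Z) w2).
have fF1 : fin2 F1.
  exists (M3 + `|N1|)%N => i j ij; rewrite /F1.
  have [Mi|Nj] : (M3 <= i)%N \/ (`|N1| <= j)%N by lia.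
    by rewrite HN3 ?HM3.
  by rewrite HN1 ?(lin0 (bilin_linl _ _ b3)) //; lia.
have fF2 : fin2 F2.
  apply/fin2_tr/fin2_rows => [|j].
    by exists `|N2|%N => j Nj i; rewrite /F2 HN2 ?Iz //; lia.
  have [N HN] := tI (Y1 u j%:Z w1) w2.
  exists (`|N| + `|(k + c - j%:Z)%R|)%N => i Ni.
  by rewrite /F2 HN ?Yz //; lia.
have fl w := bounded_right_fin (fun i => p + r - i%:Z) (left_bounded b3 tI v w1 w c).
have -> : Y3 u k (left_term Y3 I v w1 w2 r p c) - left_term Y3 I v w1 (Y2 u k w2) r p c =
    isum (fun i => sbin r i *: (isum (fun j => binz k j *: F1 i j) + isum (fun j => binz k j *: F2 i j))).
  rewrite /left_term /product_modes (lin_isum (bilin_linr _ _ b3)); last exact: finZ.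
  rewrite -isumB; [|apply: (lin_fin (bilin_linr _ _ b3)); exact: finZ|exact: finZ].
  apply: eq_isum => i; rewrite (linZ (bilin_linr _ _ b3)) -scalerBr; congr (_ *: _).
  set x := p + r - i%:Z; set y := c + i%:Z.
  have -> : isum (fun j => binz k j *: F1 i j) = iter_term Y Y3 u v (I w1 y w2) 0 k x.
    rewrite /iter_term /iterate_modes; apply: eq_isum => j.
    by rewrite /F1 add0r; congr (_ *: Y3 _ _ _); rewrite /x; lia.
  have -> : isum (fun j => binz k j *: F2 i j) = Y3 v x (iter_term Y1 I u w1 w2 0 k y).
    rewrite /iter_term /iterate_modes (lin_isum (bilin_linr _ _ b3)); last first.
      by apply: finZ; exact: (bounded_left_fin 0 (fun j => k + y - j%:Z) (iter_bounded bI t1 u w1 w2)).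
    apply: eq_isum => j; rewrite (linZ (bilin_linr _ _ b3)) /F2 add0r.
    by congr (_ *: Y3 _ _ (I _ _ _)); rewrite /y; lia.
  rewrite weak_module_commutator // (commutator commI) (linB (bilin_linr _ _ b3)).
  by rewrite addrA subrK.
have fin_row G : fin2 G -> fin (fun i => isum (fun j => binz k j *: G i j)).
  move=> [M HM]; exists M => i Mi; apply: isum_eq0 => j.
  by rewrite HM ?Mi // scaler0.
under eq_isum do rewrite scalerDr.
rewrite isumD; [|by apply: finZ; exact: fin_row|by apply: finZ; exact: fin_row].
congr (_ + _); rewrite exchange_isum_scale //; apply: eq_isum => j; congr (_ *: _).
  rewrite /left_term /product_modes; apply: eq_isum => i.
  by rewrite /F1; congr (_ *: Y3 _ _ _); lia.
rewrite /left_term /product_modes; apply: eq_isum => i.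
by rewrite /F2; congr (_ *: Y3 _ _ (I _ _ _)); lia.
Qed.

Variable r : int.
Hypothesis defect_succ : forall v w1 w2 p q, jacobi_defect Y1 Y2 Y3 I v w1 w2 (r + 1) p q = 0.

Lemma defect_transfer v w1 w2 p q p' q' : p + q = p' + q' ->
  jacobi_defect Y1 Y2 Y3 I v w1 w2 r p q = jacobi_defect Y1 Y2 Y3 I v w1 w2 r p' q'.
Proof. by apply: mode_rec_transfer => [|p0 q0]; [exact: jacobi_defect_rec|exact: defect_succ]. Qed.

Lemma right_term_large v w2 : exists B : int, forall w1 p q, B <= p ->
  right_term Y2 I v w1 w2 r p q = 0.
Proof.
have [N HN] := t2 v w2; exists N => w1 p q Np.
rewrite /right_term /product_modes isum_eq0 ?scaler0 // => i.
by rewrite HN ?(lin0 (bilin_linr _ _ bI)) ?scaler0 //; lia.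
Qed.

(** By [defect_transfer] only [p + q] matters, so [p = 0] is just a normalization. *)
Definition defect_op w1 (v : V) (s : int) (w2 : W2) : W3 :=
  jacobi_defect Y1 Y2 Y3 I v w1 w2 r 0 s.

Lemma defect_op_truncated w1 : truncated (defect_op w1).
Proof.
move=> v w2; have [N1 HN1] := tI (Y1 v r w1) w2; have [N2 HN2] := tI w1 w2.
have [N3 HN3] := t2 v w2.
have [B HB] : exists B : int, forall i : nat, (i < `|N3|)%N -> forall n, B <= n -> I w1 n (Y2 v i%:Z w2) = 0.
  elim: (`|N3|%N) => [|M [B IH]]; first by exists 0.
  have [B' HB'] := tI w1 (Y2 v M%:Z w2).
  exists (`|B|%N + `|B'|%N)%N%:Z => i; rewrite ltnS leq_eqVlt => /orP[/eqP ->|iM] n Bn.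
    by apply: HB'; lia.
  by apply: IH => //; lia.
exists (`|N1| + `|N2| + `|B| + `|N3| + `|r|)%N%:Z => s Ns.
rewrite /defect_op /jacobi_defect /iter_term iterate_modes0 HN1; last lia.
rewrite /left_term /right_term /product_modes isum_eq0 => [|i]; last first.
  by rewrite HN2 ?(lin0 (bilin_linr _ _ b3)) ?scaler0 //; lia.
rewrite isum_eq0 ?scaler0 ?subr0 ?addr0 // => i.
case: (ltnP i `|N3|) => iN.
  by rewrite add0r HB ?scaler0 //; lia.
by rewrite HN3 ?(lin0 (bilin_linr _ _ bI)) ?scaler0 //; lia.
Qed.

(** Subtracting the two bracket formulas gives the commutator formula together with an error sum of
    defects on [u_j w1], [j >= 0], and these are zero by [defect_of_nonneg]. *)
Lemma defect_op_commutator_op w1 : commutator_op Y Y2 Y3 (defect_op w1).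
Proof.
split; first 1 last.
- exact: defect_op_truncated.
- move=> u v w2 k s.
  have [N HN] := tV u v; have [N' HN'] := t1 u w1.
  have [B1 HB1] := right_term_large v w2.
  have [B2 HB2] := right_term_large v (Y2 u k w2).
  have [B3 HB3] : exists B : int, forall j : nat, (j < `|N|)%N -> forall w1 p q, B <= p ->
      right_term Y2 I (Y u j%:Z v) w1 w2 r p q = 0.
    elim: (`|N|%N) => [|M [B IH]]; first by exists 0.
    have [B' HB'] := right_term_large (Y u M%:Z v) w2.
    exists (`|B|%N + `|B'|%N)%N%:Z => j; rewrite ltnS leq_eqVlt => /orP[/eqP ->|jM] w p q Bp.
      by apply: HB'; lia.
    by apply: IH => //; lia.
  (* Sliding along [p + q], the index [p] is taken so large that all the [right_term]s in play
     vanish and each defect is an iterate minus a product. *)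
  pose p := (`|B1| + `|B2| + `|B3| + `|N| + `|k|)%N.
  have I0 n w : I 0 n w = 0 by exact: lin0 (bilin_linl n w bI).
  have Y10 n : Y1 0 n w1 = 0 by exact: lin0 (bilin_linl n w1 b1).
  have Y30 n w : Y3 0 n w = 0 by exact: lin0 (bilin_linl n w b3).
  have Y1z x n : Y1 x n 0 = 0 by exact: lin0 (bilin_linr x n b1).
  have Y3z x n : Y3 x n 0 = 0 by exact: lin0 (bilin_linr x n b3).
  have dE x w y q c : right_term Y2 I x w y r q c = 0 ->
      iter_term Y1 I x w y r q c - left_term Y3 I x w y r q c = defect_op w x (q + c) y.
    move=> R0; rewrite /defect_op (@defect_transfer x w y 0 (q + c) q c) ?add0r //.
    by rewrite /jacobi_defect R0 addr0.
  have R1 (j : nat) : right_term Y2 I (Y u j%:Z v) w1 w2 r (p%:Z + k - j%:Z) (s - p%:Z) = 0.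
    case: (ltnP j `|N|) => jN; first by apply: HB3 => //; rewrite /p; lia.
    rewrite HN; last lia.
    rewrite /right_term /product_modes isum_eq0 ?scaler0 // => i.
    by rewrite (lin0 (bilin_linl _ _ b2)) (lin0 (bilin_linr _ _ bI)) scaler0.
  suff E : iter_term Y (defect_op w1) u v w2 0 k s =
      Y3 u k (defect_op w1 v s w2) - defect_op w1 v s (Y2 u k w2).
    by rewrite /jacobi_defect E /left_term /right_term !product_modes0 expr0z scale1r addrAC subrK subrr.
  have Ew y : right_term Y2 I v w1 y r p%:Z (s - p%:Z) = 0 ->
      defect_op w1 v s y = iter_term Y1 I v w1 y r p%:Z (s - p%:Z) - left_term Y3 I v w1 y r p%:Z (s - p%:Z).
    by move=> /dE ->; rewrite (_ : p%:Z + (s - p%:Z) = s) //; lia.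
  rewrite !Ew; [|by apply: HB2; rewrite /p; lia|by apply: HB1; rewrite /p; lia].
  rewrite (linB (bilin_linr _ _ b3)).
  rewrite subr_subACA iter_term_bracket left_term_bracket opprD addrACA.
  have fi1 : fin (fun j => iter_term Y1 I (Y u j%:Z v) w1 w2 r (p%:Z + k - j%:Z) (s - p%:Z)).
    exists `|N|%N => j Nj; rewrite HN /iter_term /iterate_modes ?isum_eq0 // => [i|]; last lia.
    by rewrite (lin0 (bilin_linl _ _ b1)) I0 scaler0.
  have fl1 : fin (fun j => left_term Y3 I (Y u j%:Z v) w1 w2 r (p%:Z + k - j%:Z) (s - p%:Z)).
    exists `|N|%N => j Nj; rewrite HN /left_term /product_modes ?isum_eq0 // => [i|]; last lia.
    by rewrite Y30 scaler0.
  have fi2 : fin (fun j => iter_term Y1 I v (Y1 u j%:Z w1) w2 r p%:Z (k + (s - p%:Z) - j%:Z)).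
    exists `|N'|%N => j Nj; rewrite HN' /iter_term /iterate_modes ?isum_eq0 // => [i|]; last lia.
    by rewrite Y1z I0 scaler0.
  have fl2 : fin (fun j => left_term Y3 I v (Y1 u j%:Z w1) w2 r p%:Z (k + (s - p%:Z) - j%:Z)).
    exists `|N'|%N => j Nj; rewrite HN' /left_term /product_modes ?isum_eq0 // => [i|]; last lia.
    by rewrite I0 Y3z scaler0.
  rewrite -!isumB; try exact: finZ.
  rewrite [X in _ = _ + X]isum_eq0 ?addr0 => [|j].
    apply: eq_isum => j; rewrite -scalerBr dE // add0r; congr (_ *: defect_op _ _ _ _); lia.
  rewrite -scalerBr dE; last by apply: HB1; rewrite /p; lia.
  by rewrite /defect_op (defect_of_nonneg modV mod1 mod2 mod3 commI) scaler0.
split=> s a x y z.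
  by apply: jacobi_defect_lin1.
by apply: jacobi_defect_lin3.
Qed.

(* If all defects at [r + 1] vanish, the one at [r] depends on [p + q] only, hence is
   the operator [defect_op]; being again a commutator operator, now on [V] itself,
   it satisfies the Jacobi identity as soon as [V] is spanned by nonnegative modes.
   It kills the vacuum, so it vanishes. *)
Lemma defect_eq0 : (forall v, Y v (-1) vac = v) ->
  gV_ge0_full Y -> r < 0 ->
  forall v w1 w2 p q, jacobi_defect Y1 Y2 Y3 I v w1 w2 r p q = 0.
Proof.
move=> creation full r0 v w1 w2 p q.
rewrite (@defect_transfer _ _ _ p q 0 (p + q)) ?add0r // -/(defect_op w1 v (p + q) w2).
have commE := defect_op_commutator_op w1.
have [bE tE _] := commE.
have v1 : vacuum_id vac Y1 by case: mod1.
have v2 : vacuum_id vac Y2 by case: mod2.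
have v3 : vacuum_id vac Y3 by case: mod3.
have Jac u x y r' p' q' : jacobi_defect Y Y2 Y3 (defect_op w1) u x y r' p' q' = 0.
  apply: (in_span_eq0 (f := fun x => jacobi_defect Y Y2 Y3 (defect_op w1) u x y r' p' q') _ _ (full x)).
    exact: jacobi_defect_lin2.
  move=> _ [a [b [n [n0 ->]]]]; case: n n0 => // n _.
  exact: (defect_of_nonneg modV modV mod2 mod3 commE).
(* As [r < 0], the mode [r - i] of [vac] can equal [-1] only for [i = 0]; the two surviving terms
   agree. *)
have Evac s y : defect_op w1 vac s y = 0.
  rewrite /defect_op /jacobi_defect /iter_term iterate_modes0 v1 /left_term /right_term /product_modes.
  rewrite isum_head => [|i]; last by rewrite v3 ifF ?scaler0 //; lia.
  rewrite isum_eq0 => [|i]; last first.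
    rewrite v2; have -> : (0 + i%:Z == -1) = false by lia.
    by rewrite (lin0 (bilin_linr _ _ bI)) scaler0.
  rewrite scaler0 addr0 sbin0 scale1r v3 (_ : 0 + r - 0%N%:Z = r); last lia.
  case: ifP => _; first by rewrite (_ : s + 0%N%:Z = s) ?subrr //; lia.
  by rewrite (lin0 (bilin_linl _ _ bI)) subrr.
(* At these indices the iterate is [defect_op] at [v_(-1) vac = v], while both products contain
   [defect_op] at [vac]. *)
have := Jac v vac w2 (-1) 0 (p + q).
rewrite /jacobi_defect /iter_term iterate_modes0 creation /left_term /right_term /product_modes.
rewrite isum_eq0 => [|i]; last by rewrite Evac (lin0 (bilin_linr _ _ b3)) scaler0.
by rewrite isum_eq0 => [|i]; rewrite ?scaler0 ?subr0 ?addr0 // Evac scaler0.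
Qed.

End DefectOperator.

Lemma commutator_op_jacobi (V W1 W2 W3 : lmodType C) (Y : V -> int -> V -> V) (vac : V)
  (Y1 : V -> int -> W1 -> W1) (Y2 : V -> int -> W2 -> W2) (Y3 : V -> int -> W3 -> W3)
  (I : W1 -> int -> W2 -> W3) :
  weak_module Y vac Y -> (forall v, Y v (-1) vac = v) -> gV_ge0_full Y ->
  weak_module Y vac Y1 -> weak_module Y vac Y2 -> weak_module Y vac Y3 ->
  commutator_op Y1 Y2 Y3 I ->
  forall v w1 w2 r p q, jacobi_defect Y1 Y2 Y3 I v w1 w2 r p q = 0.
Proof.
move=> modV creation full mod1 mod2 mod3 commI.
have [bI tI comm0] := commI.
have [b1 t1 _ _] := mod1; have [b2 t2 _ _] := mod2; have [b3 t3 _ _] := mod3.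
suff H : forall r v w1 w2 p q, jacobi_defect Y1 Y2 Y3 I v w1 w2 r p q = 0.
  by move=> *; exact: H.
have ge0 (n : nat) v w1 w2 p q : jacobi_defect Y1 Y2 Y3 I v w1 w2 n%:Z p q = 0.
  apply: mode_rec_ge0; [exact: jacobi_defect_rec | exact: comm0].
apply: (@int_ind_down _ 0) => [[] //|r IHr v w1 w2 p q].
case: (leP 0 r) => [|r0]; first by case: r {IHr} => // n _; exact: ge0.
exact: (defect_eq0 modV mod1 mod2 mod3 commI IHr creation full r0).
Qed.

(** * From complex modes to integer modes *)

Lemma Re_bounded_below (s : C) (N : int) :
  exists M : int, forall n : int, M <= n -> N%:~R < 'Re (s + n%:~R).
Proof.
have [k Hk] : exists k : nat, `|'Re s| < k%:R.
  pose x := complex.Re s; exists (Num.bound `|x|).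
  have -> : 'Re s = x%:C%C by rewrite /x complexRe.
  rewrite normc_def /= expr0n addr0 sqrtr_sqr.
  have -> : (Num.bound `|x|)%:R = ((Num.bound `|x|)%:R)%:C%C :> C by rewrite rmorph_nat.
  by rewrite ltcR; exact: archi_boundP.
exists (N + k%:Z + 1) => n Mn.
have -> : 'Re (s + n%:~R) = 'Re s + n%:~R :> C.
  have /Creal_ReP e : (n%:~R : C) \is Num.real by rewrite realz.
  by rewrite raddfD /= e.
have nR : (N + k%:Z + 1)%:~R <= n%:~R :> C by rewrite ler_int.
have rs : 'Re s \is Num.real by exact: Creal_Re.
have : - k%:R < 'Re s by have := Hk; rewrite real_ltr_norml // => /andP[].
move=> Hs; apply: (lt_le_trans _ (lerD (ltW Hs) nR)).
rewrite !rmorphD /= (_ : _ + _ = N%:~R + 1); last by rewrite -pmulrn; ring.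
by rewrite ltrDl ltr01.
Qed.

Section BaseShift.
Variables (V W1 W2 W3 : lmodType C) (om : V).
Variables (Y1 : V -> int -> W1 -> W1) (Y2 : V -> int -> W2 -> W2) (Y3 : V -> int -> W3 -> W3).
Variable I : W1 -> C -> W2 -> W3.
Hypothesis quasiI : quasi_intertwining om Y1 Y2 Y3 I.

(* The identities relate only modes in one coset of [int] in [C]. *)
Definition coset_modes (s : C) (w1 : W1) (n : int) (w2 : W2) : W3 := I w1 (s + n%:~R) w2.

Lemma coset_modes_commutator_op s : bilin Y1 -> bilin Y2 -> bilin Y3 -> truncated Y1 ->
  commutator_op Y1 Y2 Y3 (coset_modes s).
Proof.
move=> b1 b2 b3 t1; have [[bl br] tI comm _] := quasiI; split.
- by split=> n a x y z; [exact: bl|exact: br].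
- move=> w1 w2; have [N HN] := tI w1 w2; have [M HM] := Re_bounded_below s N.
  by exists M => n /HM; exact: HN.
move=> v w1 w2 p q; have [N HN] := t1 v w1.
have Yz (i : nat) : (`|N| <= i)%N -> Y1 v i%:Z w1 = 0 by move=> Ni; apply: HN; lia.
have := comm v w1 w2 p (s + q%:~R) `|N|%N Yz => E.
rewrite /jacobi_defect /left_term /right_term !product_modes0 expr0z scale1r.
have {}E : Y3 v p (coset_modes s w1 q w2) - coset_modes s w1 q (Y2 v p w2) =
    iter_term Y1 (coset_modes s) v w1 w2 0 p q.
  rewrite [LHS]E /iter_term /iterate_modes (@isumE _ _ `|N|%N) => [|i Ni].
    apply: eq_bigr => i _; rewrite add0r /coset_modes; congr (_ *: I _ _ _).
    by rewrite rmorphB rmorphD /= -pmulrn; ring.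
  by rewrite add0r Yz // /coset_modes (lin0 (fun a x y => bl _ a x y w2)) scaler0.
by rewrite -E addrAC subrK subrr.
Qed.

Lemma coset_modes_intertwining : bilin Y3 ->
  (forall s v w1 w2 r p q, jacobi_defect Y1 Y2 Y3 (coset_modes s) v w1 w2 r p q = 0) ->
  intertwining om Y1 Y2 Y3 I.
Proof.
move=> b3 jac; split=> // v w1 w2 p r q N HN; have [[bl br] _ _ _] := quasiI.
have Il0 n w : I 0 n w = 0 by exact: (lin0 (fun a x y => bl n a x y w)).
have Ir0 w n : I w n 0 = 0 by exact: (lin0 (fun a x y => br n a w x y)).
(* The base point is [q] itself, so the complex mode [q] has integer index [0]. *)
have := jac q v w1 w2 r p 0.
have e0 (i : nat) : (0 + i%:Z)%:~R = i%:R :> C by rewrite add0r -pmulrn.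
have e1 (i : nat) : q + (p + 0 - i%:Z)%:~R = p%:~R + q - i%:R.
  by rewrite addr0 rmorphB /= -pmulrn; ring.
have e2 (i : nat) : q + (0 + r - i%:Z)%:~R = q + r%:~R - i%:R.
  by rewrite add0r rmorphB /= -pmulrn; ring.
rewrite /jacobi_defect /iter_term /left_term /right_term /iterate_modes /product_modes /coset_modes.
rewrite (@isumE _ _ N) => [|i /HN[-> _ _]]; last by rewrite Il0 scaler0.
rewrite (@isumE _ _ N) => [|i /HN[_ HI _]]; last first.
  by rewrite e0 HI (lin0 (bilin_linr _ _ b3)) scaler0.
rewrite (@isumE _ _ N) => [|i /HN[_ _ ->]]; last by rewrite Ir0 scaler0.
under [X in X - _ + _ = 0]eq_bigr do rewrite e1.
under [X in _ - X + _ = 0]eq_bigr do rewrite e0.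
under [X in _ *: X]eq_bigr do rewrite e2.
move/eqP; rewrite -addrA addr_eq0 opprD opprK => /eqP.
rewrite scaler_sumr -sumrB => E; rewrite [LHS]E.
by apply: eq_bigr => i _; rewrite scalerBr !scalerA [_ * (-1) ^ r]mulrC.
Qed.

End BaseShift.

(** * Eigenvectors, and functionals vanishing on the nonnegative modes *)

Lemma eigenvector_sum_eq0 (A : lmodType C) (f : A -> A) (h : C) (x : A) (k : nat)
  (mu : 'I_k -> C) (y : 'I_k -> A) : lin f -> f x = h *: x ->
  (forall i, f (y i) = mu i *: y i) -> (forall i, mu i != h) ->
  x = \sum_(i < k) y i -> x = 0.
Proof.
move=> lf; elim: k x mu y => [|k IHk] x mu y fx fy neq ex; first by rewrite ex big_ord0.
set m := mu ord_max; have hm : h - m != 0 by rewrite subr_eq0 eq_sym neq.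
pose wid := widen_ord (leqnSn k).
(* Applying [f - m] removes the last summand and multiplies [x] by [h - m != 0]. *)
suff : (h - m) *: x = 0 by move/eqP; rewrite scaler_eq0 (negPf hm) => /eqP.
apply: (IHk _ (fun i => mu (wid i)) (fun i => (mu (wid i) - m) *: y (wid i))) => [|i|i|].
- by rewrite (linZ lf) fx !scalerA mulrC.
- by rewrite (linZ lf) fy !scalerA mulrC.
- exact: neq.
rewrite scalerBl -fx ex (lin_sum _ _ _ lf) scaler_sumr -sumrB big_ord_recr /= fy subrr addr0.
by apply: eq_bigr => i _; rewrite fy scalerBl.
Qed.

Lemma in_span_lin (A : lmodType C) (P : A -> Prop) (a : C) (x y : A) :
  in_span P x -> in_span P y -> in_span P (a *: x + y).
Proof.
move=> [k [c [b [Pb ->]]]] [l [d [e [Pe ->]]]].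
exists (k + l)%N.
exists (fun i => match split i with inl j => a * c j | inr j => d j end).
exists (fun i => match split i with inl j => b j | inr j => e j end).
split=> [i|]; first by case: split.
rewrite big_split_ord /= scaler_sumr; congr (_ + _); apply: eq_bigr => i _.
  by rewrite (unsplitK (inl i)) scalerA.
by rewrite (unsplitK (inr i)).
Qed.

Lemma in_span_gen (A : lmodType C) (P : A -> Prop) (a : C) (x : A) : P x -> in_span P (a *: x).
Proof. by move=> Px; exists 1%N, (fun=> a), (fun=> x); rewrite big_ord1. Qed.

Lemma in_span0 (A : lmodType C) (P : A -> Prop) : in_span P 0.
Proof.
by exists 0%N, (fun=> 0), (fun=> 0); rewrite big_ord0; split=> // -[].
Qed.

Definition subspace (A : lmodType C) (U : A -> Prop) :=
  U 0 /\ forall (a : C) x y, U x -> U y -> U (a *: x + y).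

Lemma subspaceD (A : lmodType C) (U : A -> Prop) x y : subspace U -> U x -> U y -> U (x + y).
Proof. by move=> [_ H] Ux Uy; rewrite -[x]scale1r; exact: H. Qed.

Lemma subspaceZ (A : lmodType C) (U : A -> Prop) (a : C) x : subspace U -> U x -> U (a *: x).
Proof. by move=> [U0 H] Ux; rewrite -[_ *: _]addr0; exact: H. Qed.

Lemma subspaceB (A : lmodType C) (U : A -> Prop) x y : subspace U -> U x -> U y -> U (x - y).
Proof.
by move=> sU Ux Uy; apply: subspaceD => //; rewrite -scaleN1r; exact: subspaceZ.
Qed.

Lemma functional_of_codim1 (A : lmodType C) (U : A -> Prop) (b : A) :
  subspace U -> (forall x, exists a : C, U (x - a *: b)) -> ~ U b ->
  exists l : A -> C, [/\ forall (a : C) x y, l (a *: x + y) = a * l x + l y,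
    forall x, U x -> l x = 0 & l b = 1].
Proof.
move=> sU Ub bU; pose l x := projT1 (cid (Ub x)).
have lU x : U (x - l x *: b) by rewrite /l; case: cid.
have uniq x a : U (x - a *: b) -> l x = a.
  move=> Ua; apply: contrapT => /eqP la; apply: bU.
  have := subspaceB sU Ua (lU x).
  rewrite opprB addrC addrA subrK -scalerBl => /(subspaceZ (l x - a)^-1 sU).
  by rewrite scalerA mulVf ?scale1r // subr_eq0.
exists l; split=> [a x y|x Ux|].
- apply: uniq; rewrite scalerDl -scalerA opprD addrACA -scalerBr.
  by apply: (proj2 sU).
- by apply: uniq; rewrite scale0r subr0.
- by apply: uniq; rewrite scale1r subrr; exact: (proj1 sU).
Qed.

(** The last vector is adjoined to [U]: either this gives everything and [U] has codimension one, or
    the larger subspace is still proper and fewer vectors are left. *)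
Lemma functional_of_finite_codim (A : lmodType C) (U : A -> Prop) (k : nat) (b : 'I_k -> A) :
  subspace U -> (forall x, exists a : 'I_k -> C, U (x - \sum_(i < k) a i *: b i)) ->
  (exists x, ~ U x) ->
  exists l : A -> C, [/\ forall (a : C) x y, l (a *: x + y) = a * l x + l y,
    forall x, U x -> l x = 0 & exists x, l x != 0].
Proof.
elim: k U b => [|k IHk] U b sU Ub [x0 Ux0].
  by have [a] := Ub x0; rewrite big_ord0 subr0.
pose U' x := exists a : C, U (x - a *: b ord_max).
have UU' x : U x -> U' x by move=> Ux; exists 0; rewrite scale0r subr0.
case: (pselect (forall x, U' x)) => [allU'|/existsNP nU'].
  have Ubm : ~ U (b ord_max).
    move=> Ubm; apply: Ux0; have [a Ua] := allU' x0.
    rewrite -[x0](subrK (a *: b ord_max)); apply: subspaceD => //; exact: subspaceZ.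
  have [l [ll lU lb]] := functional_of_codim1 sU allU' Ubm.
  by exists l; split=> //; exists (b ord_max); rewrite lb oner_eq0.
have sU' : subspace U'.
  split=> [|a x y [c Uc] [d Ud]]; first exact/UU'/(proj1 sU).
  exists (a * c + d); rewrite scalerDl -scalerA opprD addrACA -scalerBr.
  by apply: (proj2 sU).
have [//|l [ll lU' lx]] := IHk U' (fun i => b (widen_ord (leqnSn k) i)) sU' _ nU'.
  move=> x; have [a Ua] := Ub x; exists (fun i => a (widen_ord (leqnSn k) i)), (a ord_max).
  by move: Ua; rewrite big_ord_recr /= opprD addrA.
by exists l; split=> // x /UU'; exact: lU'.
Qed.

Section VertexOperatorAlgebra.
Variables (V : lmodType C) (Y : V -> int -> V -> V) (vac om : V).
Hypothesis voaV : is_VOA Y vac om.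

Lemma VOA_weak_module : weak_module Y vac Y.
Proof. by case: voaV => [[]]. Qed.

Lemma VOA_L0_lin : lin (Y om 1).
Proof. by have [bV _ _ _] := VOA_weak_module; exact: bilin_linr. Qed.

(** [V] is graded by integers while a module admits complex weights, so the point is that a
    nonintegral [h] has no eigenvectors. *)
Lemma VOA_V_module : V_module Y vac om Y.
Proof.
have [_ _ _ _ [_ dec fd low]] := voaV.
have noint (h : C) (v : V) : ~ (exists n : int, h = n%:~R) -> Y om 1 v = h *: v -> v = 0.
  move=> hn hv; have [k [ns [vs [Hvs ev]]]] := dec v.
  apply: (eigenvector_sum_eq0 (mu := fun i => (ns i)%:~R) VOA_L0_lin hv Hvs _ ev).
  by move=> i; apply/eqP => e; apply: hn; exists (ns i).
split; first exact: VOA_weak_module.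
- move=> v; have [k [ns [vs [Hvs ev]]]] := dec v.
  by exists k, (fun i => (ns i)%:~R), vs.
- move=> h; case: (pselect (exists n : int, h = n%:~R)) => [[n ->]|hn]; first exact: fd.
  exists 0%N, (fun=> 0) => x /(noint _ _ hn) ->.
  by exists (fun=> 0); rewrite big_ord0.
move=> h; have [N HN] := low.
case: (pselect (exists n : int, h = n%:~R)) => [[n ->]|hn].
  exists (N - n) => m mN w; rewrite -rmorphD => /HN; apply; lia.
exists 0 => m _ w; apply: noint => -[n e]; apply: hn; exists (n - m).
by rewrite rmorphB /= -e addrK.
Qed.

Lemma VOA_functional : ~ gV_ge0_full Y ->
  exists l : V -> C, [/\ forall (a : C) x y, l (a *: x + y) = a * l x + l y,
    forall u v (n : int), 0 <= n -> l (Y u n v) = 0 & exists x, l x != 0].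
Proof.
move=> nfull; have [_ _ _ _ [_ dec fd _]] := voaV.
pose P (y : V) := exists (u v : V) (n : int), 0 <= n /\ y = Y u n v.
have sU : subspace (in_span P) by split; [exact: in_span0|exact: in_span_lin].
have [k [b Hb]] := fd 0.
have [|//|l [ll lU lx]] := @functional_of_finite_codim V (in_span P) k b sU.
- move=> x; have [m [ns [vs [Hvs ->]]]] := dec x.
  apply: (big_ind (fun x => exists a : 'I_k -> C, in_span P (x - \sum_(i < k) a i *: b i))).
  + exists (fun=> 0); rewrite big1 ?subr0; first exact: in_span0.
    by move=> i _; rewrite scale0r.
  + move=> y z [a Ua] [c Uc]; exists (fun i => a i + c i).
    under eq_bigr do rewrite scalerDl.
    by rewrite big_split /= opprD addrACA; exact: subspaceD.
  move=> i _; have [n0|n0] := eqVneq (ns i) 0.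
    have [|a ->] := Hb (vs i); first by rewrite Hvs n0.
    by exists a; rewrite subrr; exact: in_span0.
  exists (fun=> 0); rewrite big1 ?subr0; last by move=> j _; rewrite scale0r.
  (* A vector of nonzero weight is a multiple of its own image under the nonnegative mode [L(0)];
     only weight zero can stay outside the span. *)
  have -> : vs i = ((ns i)%:~R)^-1 *: Y om 1 (vs i).
    by rewrite Hvs scalerA mulVf ?scale1r // intr_eq0.
  by apply: in_span_gen; exists om, (vs i), 1.
- by apply/existsNP.
exists l; split=> // u v n n0; apply: lU; rewrite -[Y u n v]scale1r.
by apply: in_span_gen; exists u, v, n.
Qed.

End VertexOperatorAlgebra.

(** The excluded identity is what either counterexample would satisfy if it failed. If [l vac != 0]
    it makes [V] the line of [vac]; otherwise it forces [vac = 0], hence [V = 0]. *)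
Lemma VOA_functional_not_vacuum (V : lmodType C) (Y : V -> int -> V -> V) (vac om : V) (l : V -> C) :
  is_VOA Y vac om -> ~ dim_le1 V -> (exists x, l x != 0) ->
  ~ (forall v, l v *: vac = l vac *: v).
Proof.
move=> voaV dimV [x lx] E; apply: dimV; exists vac => v.
case: (eqVneq (l vac) 0) => lvac; last first.
  by exists ((l vac)^-1 * l v); rewrite -scalerA E scalerA mulVf ?scale1r.
have vac0 : vac = 0.
  by apply/eqP; have /eqP := E x; rewrite lvac scale0r scaler_eq0 (negPf lx).
exists 0; rewrite scale0r.
have [bV _ vV _] := VOA_weak_module voaV.
have := vV (-1) v; rewrite eqxx => <-.
by rewrite vac0; exact: (lin0 (bilin_linl _ v bV)).
Qed.

(** * The counterexamples *)

Section NotFull.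
Variables (V : lmodType C) (Y : V -> int -> V -> V) (vac om : V) (l : V -> C).
Hypotheses (voaV : is_VOA Y vac om).
Hypothesis llin : forall (a : C) x y, l (a *: x + y) = a * l x + l y.
Hypothesis l_nonneg : forall u v (n : int), 0 <= n -> l (Y u n v) = 0.
Hypothesis l_vac : ~ (forall v, l v *: vac = l vac *: v).

Lemma functional_g_hom : g_hom Y Y (fun w => l w *: vac).
Proof.
have [_ annih _ _ _] := voaV; have [bV _ _ _] := VOA_weak_module voaV.
split=> [a x y|v n w n0]; first by rewrite llin scalerDl scalerA.
by rewrite l_nonneg // scale0r (linZ (bilin_linr _ _ bV)) annih // scaler0.
Qed.

Lemma functional_not_V_hom : ~ V_hom Y Y (fun w => l w *: vac).
Proof.
move=> [_ H]; apply: l_vac => v; have [[_ creation] _ _ _ _] := voaV.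
have [bV _ _ _] := VOA_weak_module voaV.
by have := H v (-1) vac; rewrite creation (linZ (bilin_linr _ _ bV)) creation.
Qed.

(** The series constant in [x]: the power [x^0] carries the mode [-1]. *)
Definition vacuum_operator (w1 : V) (n : C) (w2 : V) : V := if n == -1 then l w1 *: w2 else 0.

Lemma vacuum_operator_quasi : quasi_intertwining om Y Y Y vacuum_operator.
Proof.
have [bV _ _ _] := VOA_weak_module voaV.
rewrite /vacuum_operator; split.
- split=> n a x y z; case: eqP => _; rewrite ?scaler0 ?addr0 //.
    by rewrite llin scalerDl scalerA.
  by rewrite scalerDr !scalerA mulrC.
- move=> w1 w2; exists 0 => n n0; case: eqP => // en; move: n0.
  rewrite en; have /Creal_ReP -> : (-1 : C) \is Num.real by rewrite realN real1.
  by rewrite mulr0z oppr_gt0 ltr10.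
- move=> v w1 w2 p q N _; rewrite big1 => [|i _]; last first.
    by rewrite l_nonneg // scale0r if_same scaler0.
  case: eqP => _; last by rewrite (lin0 (bilin_linr _ _ bV)) subr0.
  by rewrite (linZ (bilin_linr _ _ bV)) subrr.
move=> w1 n w2; rewrite l_nonneg // scale0r if_same.
case: eqP => [e|]; last by rewrite scaler0.
have -> : n = 0 by rewrite -[n](subrK 1) e addNr.
by rewrite oppr0 scale0r.
Qed.

Lemma vacuum_operator_not_intertwining : ~ intertwining om Y Y Y vacuum_operator.
Proof.
move=> [_ jac]; apply: l_vac => v; have [[_ creation] annih _ _ _] := voaV.
have [bV _ _ _] := VOA_weak_module voaV.
(* Here the iterate is [l v *: vac] and the product [v_(-1) (l vac *: vac) = l vac *: v]; the
   reversed term has mode [-2], hence is zero. *)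
have := jac v vac vac 0 (-1) (-1) 1%N.
rewrite !big_ord1 /= /vacuum_operator -/(binz 0 0) -/(binz (-1) 0) -/(sbin (-1) 0).
rewrite binz0 sbin0 !scale1r mulr0z sub0r !subr0 addr0 !eqxx.
have -> : (-1 + (-1)%:~R == -1 :> C) = false.
  by rewrite -subr_eq0 addrAC subrr add0r mulrN1z oppr_eq0 oner_eq0.
rewrite scaler0 subr0 (linZ (bilin_linr _ _ bV)) !creation => -> // i i0; split.
- by rewrite annih //; lia.
- case: eqP => // /eqP; rewrite -subr_eq0 addrAC subrr add0r pnatr_eq0 => /eqP i00.
  by rewrite i00 in i0.
- by rewrite annih.
Qed.

End NotFull.

Theorem mainTheorem15 (V : lmodType C) (Y : V -> int -> V -> V) (vac om : V) :
  is_VOA Y vac om ->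
  (gV_ge0_full Y ->
     (forall (W1 W2 : lmodType C) (Y1 : V -> int -> W1 -> W1)
             (Y2 : V -> int -> W2 -> W2) (f : W1 -> W2),
        weak_module Y vac Y1 -> weak_module Y vac Y2 ->
        g_hom Y1 Y2 f -> V_hom Y1 Y2 f) /\
     (forall (W1 W2 W3 : lmodType C) (Y1 : V -> int -> W1 -> W1)
             (Y2 : V -> int -> W2 -> W2) (Y3 : V -> int -> W3 -> W3)
             (I : W1 -> C -> W2 -> W3),
        weak_module Y vac Y1 -> weak_module Y vac Y2 -> weak_module Y vac Y3 ->
        quasi_intertwining om Y1 Y2 Y3 I -> intertwining om Y1 Y2 Y3 I)) /\
  (~ gV_ge0_full Y -> ~ dim_le1 V ->
     (exists (W1 W2 : lmodType C) (Y1 : V -> int -> W1 -> W1)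
             (Y2 : V -> int -> W2 -> W2) (f : W1 -> W2),
        [/\ V_module Y vac om Y1, V_module Y vac om Y2, g_hom Y1 Y2 f & ~ V_hom Y1 Y2 f]) /\
     (exists (W1 W2 W3 : lmodType C) (Y1 : V -> int -> W1 -> W1)
             (Y2 : V -> int -> W2 -> W2) (Y3 : V -> int -> W3 -> W3)
             (I : W1 -> C -> W2 -> W3),
        [/\ V_module Y vac om Y1, V_module Y vac om Y2, V_module Y vac om Y3,
            quasi_intertwining om Y1 Y2 Y3 I & ~ intertwining om Y1 Y2 Y3 I])).
Proof.
move=> voaV; have [[modV creation] _ _ _ _] := voaV; split=> [full|nfull dimV].
  split=> [W1 W2 Y1 Y2 f mod1 mod2|W1 W2 W3 Y1 Y2 Y3 I mod1 mod2 mod3 quasiI].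
    exact: (g_hom_V_hom modV creation full mod1 mod2).
  have [b1 t1 _ _] := mod1; have [b2 t2 _ _] := mod2; have [b3 t3 _ _] := mod3.
  apply: (coset_modes_intertwining quasiI b3) => s.
  apply: (commutator_op_jacobi modV creation full mod1 mod2 mod3).
  exact: coset_modes_commutator_op quasiI _ _ _ _ _.
have [l [llin l_nonneg lx]] := VOA_functional voaV nfull.
have l_vac := VOA_functional_not_vacuum voaV dimV lx.
have modY := VOA_V_module voaV.
split.
  exists V, V, Y, Y, (fun w => l w *: vac); split=> //.
    exact: (functional_g_hom voaV).
  exact: functional_not_V_hom voaV l_vac.
exists V, V, V, Y, Y, Y, (vacuum_operator l); split=> //.
  exact: (vacuum_operator_quasi voaV).
exact: vacuum_operator_not_intertwining voaV l_vac.
Qed.
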